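(* Let $d\ge1$ and $0<\lambda\le\Lambda$. There exist two small constants $\varepsilon_0>0$ and $\delta>0$, and a large constant $M>0$ (depending only on $d,\lambda,\Lambda$), such that if $0\le\gamma\le\varepsilon_0$, then for any lower semi-continuous function $u:B_1\to\mathbb R$ such that $$u\ge0\text{ in }B_1,\qquad M^-(D^2u,\nabla u)\le1\text{ in }B_1\text{ (viscosity sense)},\qquad |\{u>M\}\cap B_1|>(1-\delta)|B_1|,$$ where $M^-=M^-_{\lambda,\Lambda,\gamma}$, one has $u>1$ in $B_{1/4}$.
   Context: $B_r$ is the open ball of radius $r$ centered at the origin in $\mathbb R^d$, and $|\cdot|$ of a set is Lebesgue measure. For a symmetric matrix $X$, write $X=X^+-X^-$ with $X^\pm\ge 0$ its positive and negative parts. Given $0<\lambda\le\Lambda$ and $\gamma\ge0$, for a symmetric matrix $X$ and $p\in\mathbb R^d$ define $$M^-(X,p)=\begin{cases}\lambda\,\mathrm{tr}\,X^+-\Lambda\,\mathrm{tr}\,X^--\Lambda|p| & |p|\ge\gamma\\ -\infty&\text{otherwise.}\end{cases}$$ A lower semi-continuous $u$ satisfies $M^-(D^2u,\nabla u)\le A$ in an open set $\Omega$ in the viscosity sense if, whenever $\phi$ is $C^2$ near $x_0\in\Omega$ and $u-\phi$ has a local minimum at $x_0$, one has $M^-(D^2\phi(x_0),\nabla\phi(x_0))\le A$. (The constant $M$ is unrelated to the operator $M^-$.) *)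

(* Defs.v *)
From HB Require Import structures.
From mathcomp Require Import all_boot all_order all_algebra.
From mathcomp Require Import all_classical all_reals all_analysis.
From mathcomp Require Import complex.
Import Order.TTheory GRing.Theory Num.Theory.
Import numFieldNormedType.Exports.

Set Implicit Arguments.
Unset Strict Implicit.
Unset Printing Implicit Defensive.

Local Open Scope classical_set_scope.
Local Open Scope ring_scope.

(* The library norm of 'rV[R]_d is the sup norm, hence the explicit Euclidean
   norm here. The two induce the same topology, so neighbourhoods, derivatives
   and continuity below are the library's. *)
Definition enorm (R : realType) (d : nat) (x : 'rV[R]_d) : R :=
  Num.sqrt (\sum_(i < d) x ord0 i ^+ 2).

Definition eball (R : realType) (d : nat) (r : R) : set 'rV[R]_d :=
  [set x | enorm x < r].

Definition cons_tuple_of (T : Type) (n : nat) (z : T * n.-tuple T) :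
  n.+1.-tuple T := [tuple of z.1 :: z.2].

(* Lebesgue measure on R^n as the n-fold product of the one-dimensional one; it
   is a sigma-finite measure on the Borel sigma-algebra of R^n
   ([lebesgue_tuple_measureP]) giving boxes their volume ([volume_box]). *)
Fixpoint lebesgue_tuple (R : realType) (n : nat) :
    set (n.-tuple (measurableTypeR R)) -> \bar R :=
  match n with
  | 0 => \d_([tuple] : 0.-tuple (measurableTypeR R))
  | m.+1 => pushforward (@lebesgue_measure R \x @lebesgue_tuple R m)%E
              (@cons_tuple_of (measurableTypeR R) m)
  end.

Definition volume (R : realType) (d : nat) (A : set 'rV[R]_d) : \bar R :=
  lebesgue_tuple [set t : d.-tuple (measurableTypeR R) |
                   A (\row_(i < d) tnth t i)].

Lemma measurable_cons_tuple_of d (T : measurableType d) n :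
  measurable_fun [set: T * n.-tuple T] (@cons_tuple_of T n).
Proof.
apply: (@measurable_cons _ _ _ _ (@fst T (n.-tuple T)) n (@snd T (n.-tuple T))).
  exact: measurable_fst.
exact: measurable_snd.
Qed.

Lemma lebesgue_tuple_measureP (R : realType) n :
  exists mu : {sigma_finite_measure set (n.-tuple (measurableTypeR R)) -> \bar R},
    lebesgue_tuple (n := n) = mu.
Proof.
elim: n => [|n [mu muE]]; first by exists (\d_([tuple] : 0.-tuple (measurableTypeR R))).
pose nu0 := measure_function_pushforward__canonical__measure_function_Measure (@lebesgue_measure R \x mu)%E (@measurable_cons_tuple_of _ (measurableTypeR R) n).
pose nu : {measure set (n.+1.-tuple (measurableTypeR R)) -> \bar R} := nu0.
have nuE : lebesgue_tuple (n := n.+1) = nu by rewrite /= muE.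
have sf : sigma_finite setT nu.
  have /sigma_finiteP[F [FT ndF Foo]] := sigma_finiteT (@lebesgue_measure R).
  have /sigma_finiteP[G [GT ndG Goo]] := sigma_finiteT mu.
  pose uncons (t : n.+1.-tuple (measurableTypeR R)) :=
    (thead t : measurableTypeR R, [tuple of behead t] : n.-tuple (measurableTypeR R)).
  have uncons_cons : cancel (@cons_tuple_of (measurableTypeR R) n) uncons.
    case=> x t; rewrite /uncons /cons_tuple_of /=; congr (_, _).
    by apply/val_inj.
  have muncons : measurable_fun setT uncons.
    apply/measurable_fun_pairP; split => /=.
      exact: measurable_tnth.
    exact: measurable_behead.
  exists (fun k => uncons @^-1` (F k `*` G k)).
    rewrite -preimage_bigcup (_ : \bigcup_k (F k `*` G k) = setT) ?preimage_setT//.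
    apply/seteqP; split => // -[x t] _.
    have [k _ Fkx] : (\bigcup_k F k) x by rewrite -FT.
    have [l _ Glt] : (\bigcup_k G k) t by rewrite -GT.
    exists (maxn k l) => //; split.
    - by move: x Fkx; exact/subsetPset/ndF/leq_maxl.
    - by move: t Glt; exact/subsetPset/ndG/leq_maxr.
  move=> k; have [mF Fk] := Foo k; have [mG Gk] := Goo k.
  have mFG : measurable (F k `*` G k) by exact: measurableX.
  split; first by rewrite -[X in measurable X]setTI; exact: muncons.
  rewrite /nu /= /pushforward -comp_preimage (_ : _ \o _ = id); last first.
    by apply/funext => z /=; rewrite uncons_cons.
  by rewrite preimage_id product_measure1E// lte_mul_pinfty// ge0_fin_numE.
pose sm := Measure_isSigmaFinite.Build _ _ _ (nu : set _ -> \bar R) sf.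
pose nu' : {sigma_finite_measure set _ -> \bar R} := HB.pack (nu : set _ -> \bar R) nu sm.
by exists nu'; rewrite nuE.
Qed.

Lemma volume_box (R : realType) n (a b : 'I_n -> R) :
  (forall i, a i <= b i) ->
  volume [set x : 'rV[R]_n | forall i, a i <= x ord0 i <= b i] =
  (\prod_(i < n) (b i - a i))%:E.
Proof.
elim: n a b => [|n IH] a b ab.
  by rewrite big_ord0 /volume /= diracE mem_set// => -[].
rewrite /volume /= /pushforward.
have [mu muE] := lebesgue_tuple_measureP R n.
set A := (X in (_ \x _)%E X).
pose B := [set t : n.-tuple (measurableTypeR R) |
      [set x : 'rV[R]_n | forall i : 'I_n, a (lift ord0 i) <= x ord0 i <= b (lift ord0 i)]
        (\row_(i < n) tnth t i)].
have -> : A = `[a ord0, b ord0] `*`B.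
  apply/seteqP; split => -[x t] /=.
    move=> H; split.
      by have := H ord0; rewrite mxE /= tnth0 in_itv.
    by move=> i; have := H (lift ord0 i); rewrite !mxE tnthS.
  move=> [x0 H] i; rewrite mxE; have [j ->|->] := unliftP ord0 i.
    by have := H j; rewrite mxE tnthS.
  by rewrite tnth0 /=; move: x0; rewrite in_itv.
have mB : measurable B.
  have -> : B = \bigcap_(i in [set: 'I_n])
        ((fun t : n.-tuple (measurableTypeR R) => tnth t i) @^-1` `[a (lift ord0 i), b (lift ord0 i)]).
    apply/seteqP; split => t /= H i.
      by move=> _ /=; have := H i; rewrite mxE in_itv.
    by have := H i I; rewrite mxE /= in_itv.
  apply: fin_bigcap_measurable => // i _.
  by rewrite -[X in measurable X]setTI; exact: (@measurable_tnth _ (measurableTypeR R) n i measurableT _ (measurable_itv _)).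
rewrite muE.
transitivity ((@lebesgue_measure R) `[a ord0, b ord0]%classic * mu B)%E.
  exact: (product_measure1E (@lebesgue_measure R) mu (measurable_itv _) mB).
rewrite big_ord_recl EFinM; congr (_ * _)%E.
  rewrite lebesgue_measure_itv/= lte_fin -EFinB.
  by have := ab ord0; rewrite le_eqVlt => /predU1P[->|->//]; rewrite ltxx subrr.
by rewrite -muE -(IH (a \o lift ord0) (b \o lift ord0)) // => i; exact: ab.
Qed.

Section Matrices.
Context (R : realType) (d : nat).
Implicit Types X P N : 'M[R]_d.

Definition psdmx X : Prop :=
  X^T = X /\ forall v : 'rV[R]_d, 0 <= (v *m X *m v^T) ord0 ord0.

Definition posneg_parts X (PN : 'M[R]_d * 'M[R]_d) : Prop :=
  [/\ psdmx PN.1, psdmx PN.2, X = PN.1 - PN.2 & PN.1 *m PN.2 = 0].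

(* For symmetric [X] such a pair exists and is unique ([posneg_partsP],
   [posneg_parts_unique]), so that X^+ = [posmx X] and X^- = [negmx X]. *)
Definition posmx X : 'M[R]_d := (xget (0, 0) [set PN | posneg_parts X PN]).1.
Definition negmx X : 'M[R]_d := (xget (0, 0) [set PN | posneg_parts X PN]).2.

End Matrices.

Lemma interpolation (F : fieldType) (s : seq F) (f : F -> F) :
  exists q : {poly F}, {in s, forall x, q.[x] = f x}.
Proof.
elim: s => [|a s [q IH]]; first by exists 0.
have [as_|as_] := boolP (a \in s).
  by exists q => x; rewrite inE => /orP[/eqP ->|]; exact: IH.
pose w := \prod_(b <- s) ('X - b%:P).
have wa : w.[a] != 0.
  rewrite /w horner_prod prodf_seq_neq0; apply/allP => b bs /=.
  by rewrite hornerXsubC subr_eq0; apply: contraNneq as_ => ->.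
exists (q + ((f a - q.[a]) / w.[a])%:P * w) => x.
rewrite inE => /orP[/eqP ->|xs].
  by rewrite !hornerE divfK// addrC subrK.
rewrite !hornerE (_ : w.[x] = 0) ?mulr0 ?addr0 ?IH//.
by rewrite /w horner_prod; apply/eqP; rewrite prodf_seq_eq0; apply/hasP; exists x; rewrite //= hornerXsubC subrr.
Qed.

Lemma sym_annul (R : realType) (n : nat) (X : 'M[R]_n.+1) : X^T = X ->
  exists s : seq R, forall q : {poly R}, {in s, forall x, q.[x] = 0} ->
    horner_mx X q = 0.
Proof.
move=> Xsym.
pose XC := map_mx (real_complex R) X.
have XCherm : XC \is hermsymmx.
  apply: realsym_hermsym.
    by apply/is_hermitianmxP; rewrite expr0 scale1r map_mx_id// /XC map_trmx Xsym.
  by apply/mxOverP => i j; rewrite mxE; apply/complex_realP; exists (X i j).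
have dreal := hermitian_spectral_diag_real XCherm.
have /hermitian_normalmx/orthomx_spectralP XE := XCherm.
exists [seq complex.Re (spectral_diag XC ord0 i) | i : 'I_n.+1] => q q0.
apply: (@map_mx_inj _ _ (real_complex R)); rewrite map_horner_mx -/XC XE.
rewrite horner_mx_uconjC ?spectral_unit// horner_mx_diag.
rewrite (_ : map_mx _ _ = 0) ?map_mx0 ?raddf0 ?mulmx0 ?mul0mx//.
apply/rowP => i; rewrite !mxE.
rewrite -(RRe_real (mxOverP dreal ord0 i)) horner_map q0 ?rmorph0//.
by apply/mapP; exists i; rewrite ?mem_enum.
Qed.

Lemma psd_sqrt (R : realType) (n : nat) (X : 'M[R]_n) : X^T = X ->
  exists A B : 'M[R]_n, [/\ A^T = A, B^T = B, X = A *m A - B *m B &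
    A *m A *m (B *m B) = 0].
Proof.
case: n X => [|n] X Xsym.
  by exists 0, 0; split; apply/matrixP => -[].
have [s sP] := sym_annul Xsym.
have [r rP] := interpolation s (fun x => Num.sqrt x).
have [t tP] := interpolation s (fun x => Num.sqrt (- x)).
have symh p : (horner_mx X p)^T = horner_mx X p.
  elim/poly_ind: p => [|p c IH]; first by rewrite raddf0 trmx0.
  rewrite rmorphD rmorphM /= horner_mx_X horner_mx_C linearD /= tr_scalar_mx.
  by rewrite -[_ * _]/(_ *m _) trmx_mul IH Xsym (comm_mx_horner p (erefl (X *m X))).
exists (horner_mx X r), (horner_mx X t); split => //.
- apply/eqP; rewrite -subr_eq0; apply/eqP.
  rewrite -[X in X - _]horner_mx_X -[_ *m _]/(_ * _) -[_ *m horner_mx X t]/(_ * _) -!rmorphM -!rmorphB; apply: sP => x xs.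
  rewrite !hornerE rP// tP// -!expr2.
  have [x0|/ltW x0] := leP 0 x.
    by rewrite sqr_sqrtr// ler0_sqrtr ?oppr_le0// expr0n subr0 subrr.
  by rewrite (ler0_sqrtr x0) sqr_sqrtr ?oppr_ge0// expr0n sub0r opprK subrr.
- rewrite -[LHS]/((horner_mx X r * horner_mx X r) * (horner_mx X t * horner_mx X t)).
  rewrite -!rmorphM; apply: sP => x xs; rewrite !hornerM rP// tP//.
  have [x0|/ltW x0] := leP 0 x.
    by rewrite (@ler0_sqrtr _ (- x)) ?oppr_le0// !mulr0.
  by rewrite (ler0_sqrtr x0) !mul0r.
Qed.

Lemma form_tr_ge0 (R : realType) (m n : nat) (Y : 'M[R]_n) (A : 'M[R]_(m, n)) :
  psdmx Y -> 0 <= \tr (A *m Y *m A^T).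
Proof.
move=> [_ Y0]; apply: sumr_ge0 => i _.
have -> : (A *m Y *m A^T) i i = (row i A *m Y *m (row i A)^T) ord0 ord0.
  by rewrite -row_mul [RHS]mxE [LHS]mxE; apply: eq_bigr => j _; rewrite !mxE.
exact: Y0.
Qed.

Lemma mulmx_tr_psd (R : realType) (n : nat) (A : 'M[R]_n) : psdmx (A^T *m A).
Proof.
split=> [|v]; first by rewrite trmx_mul trmxK.
have -> : v *m (A^T *m A) *m v^T = (v *m A^T) *m (v *m A^T)^T.
  by rewrite trmx_mul trmxK !mulmxA.
rewrite mxE.
by apply: sumr_ge0 => i _; rewrite [_^T _ _]mxE -expr2 sqr_ge0.
Qed.

Lemma posneg_parts_exists (R : realType) (d : nat) (X : 'M[R]_d) :
  X^T = X -> exists PN, posneg_parts X PN.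
Proof.
move=> /psd_sqrt[A [B [At Bt XE AB]]]; exists (A *m A, B *m B).
by split => //=; [rewrite -{1}At|rewrite -{1}Bt]; exact: mulmx_tr_psd.
Qed.

Lemma tr_sym_sqr (R : realType) (n : nat) (M : 'M[R]_n) : M^T = M ->
  \tr (M *m M) <= 0 -> M = 0.
Proof.
move=> Mt; rewrite -{2}Mt.
have E : \tr (M *m M^T) = \sum_i \sum_j M i j ^+ 2.
  by apply: eq_bigr => i _; rewrite mxE; apply: eq_bigr => j _; rewrite mxE -expr2.
have ge0 i : 0 <= \sum_j M i j ^+ 2 by apply: sumr_ge0 => j _; exact: sqr_ge0.
rewrite E => le0.
have /eqP : \sum_i \sum_j M i j ^+ 2 = 0.
  by apply/eqP; rewrite eq_le le0 /=; exact: sumr_ge0.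
rewrite psumr_eq0// => /allP H; apply/matrixP => i j.
have := H i (mem_index_enum i); rewrite /= psumr_eq0; last by move=> k _; exact: sqr_ge0.
by move=> /allP/(_ j (mem_index_enum j)); rewrite /= sqrf_eq0 => /eqP ->; rewrite mxE.
Qed.

Lemma psd_root (R : realType) (n : nat) (X : 'M[R]_n) : psdmx X ->
  exists2 A : 'M[R]_n, A^T = A & X = A *m A.
Proof.
move=> pX; have [A [B [At Bt XE AB]]] := psd_sqrt pX.1.
exists A => //; rewrite XE.
suff -> : B *m B = 0 by rewrite subr0.
apply: tr_sym_sqr; first by rewrite trmx_mul Bt.
have : 0 <= \tr (B *m X *m B^T) by exact: form_tr_ge0.
have -> : \tr (B *m X *m B^T) = \tr (B *m B *m X).
  by rewrite Bt mxtrace_mulC mulmxA.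
rewrite XE mulmxBr linearB /= (mxtrace_mulC (B *m B) (A *m A)) AB.
by rewrite mxtrace0 sub0r oppr_ge0.
Qed.

Lemma psd_tr_mul (R : realType) (n : nat) (X Y : 'M[R]_n) :
  psdmx X -> psdmx Y -> 0 <= \tr (X *m Y).
Proof.
move=> /psd_root[A At ->] pY; rewrite -mulmxA mxtrace_mulC -{2}At.
exact: form_tr_ge0.
Qed.

Lemma posneg_parts_unique (R : realType) (d : nat) (X : 'M[R]_d) PN PN' :
  posneg_parts X PN -> posneg_parts X PN' -> PN = PN'.
Proof.
case: PN PN' => [P N] [P' N'] [/= pP pN XE PN0] [/= pP' pN' XE' PN0'].
have E : P - P' = N - N'.
  move: XE; rewrite XE' => /eqP; rewrite eq_sym subr_eq => /eqP ->.
  by rewrite addrC -addrA addKr addrC.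
have H : P - P' = 0.
  apply: tr_sym_sqr; first by rewrite linearB /= pP.1 pP'.1.
  rewrite {2}E mulmxBl !mulmxBr PN0 PN0' sub0r subr0 -opprD linearN linearD /=.
  by rewrite oppr_le0 addr_ge0// psd_tr_mul.
congr (_, _); apply/eqP; rewrite -subr_eq0; first by rewrite H.
by rewrite -E H.
Qed.

Lemma posneg_partsP (R : realType) (d : nat) (X : 'M[R]_d) :
  X^T = X -> posneg_parts X (posmx X, negmx X).
Proof.
move=> /posneg_parts_exists[PN H]; rewrite /posmx /negmx -surjective_pairing.
exact: (xgetPex (0, 0) (ex_intro [set Q | posneg_parts X Q] PN H)).
Qed.

Section Viscosity.
Context (R : realType) (d : nat).

Definition Mminus (lambda Lambda gamma : R) (X : 'M[R]_d)
    (p : 'rV[R]_d) : \bar R :=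
  if gamma <= enorm p then
    (lambda * \tr (posmx X) - Lambda * \tr (negmx X) - Lambda * enorm p)%:E
  else -oo%E.

Definition grad (phi : 'rV[R]_d -> R) (x : 'rV[R]_d) : 'rV[R]_d :=
  \row_(i < d) 'D_(delta_mx ord0 i) phi x.

Definition hess (phi : 'rV[R]_d -> R) (x : 'rV[R]_d) : 'M[R]_d :=
  \matrix_(i < d, j < d) 'D_(delta_mx ord0 i) (fun y => grad phi y ord0 j) x.

Definition C2_near (phi : 'rV[R]_d -> R) (x0 : 'rV[R]_d) : Prop :=
  \forall x \near x0, [/\ differentiable phi x, differentiable (grad phi) x
                        & {for x, continuous (hess phi)}].

Definition visc_Mminus_le (lambda Lambda gamma A : R) (Omega : set 'rV[R]_d)
    (u : 'rV[R]_d -> R) : Prop :=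
  forall (x0 : 'rV[R]_d) (phi : 'rV[R]_d -> R),
    Omega x0 -> C2_near phi x0 ->
    (\forall x \near x0, u x0 - phi x0 <= u x - phi x) ->
    (Mminus lambda Lambda gamma (hess phi x0) (grad phi x0) <= A%:E)%E.

(* Lower semicontinuity of the restriction of [u] to [A], via the library's
   subspace topology; [lsc_inP] is the pointwise form. *)
Definition lsc_in (A : set 'rV[R]_d) (u : 'rV[R]_d -> R) : Prop :=
  lower_semicontinuous (EFin \o u : subspace A -> \bar R).

Lemma lsc_inP (A : set 'rV[R]_d) (u : 'rV[R]_d -> R) : open A ->
  lsc_in A u <->
  forall x, A x -> forall a : R, a < u x -> \forall y \near x, a < u y.
Proof.
move=> oA.
have nE (x : 'rV[R]_d) : A x -> nbhs x = nbhs (x : subspace A).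
  by move=> Ax; apply: nbhs_subspace_interior; move: oA; rewrite openE => /(_ _ Ax).
split=> [lsc x Ax a ax|H x a ax].
  have [V nV VP] := lsc x a ax.
  rewrite -nE// in nV.
  by apply: filterS nV => y /VP; rewrite /= lte_fin.
exists [set y : 'rV[R]_d | (a < u y)%R] => //=.
have [xA|xA] := pselect (A x); first by rewrite -nE//; exact: H.
by case: (nbhs_subspaceP A x) => // _ y ->.
Qed.

End Viscosity.

(* Main.v *)
(* Slide the cusps z |-> -10 |z - x|^(1/2) from below until they touch u.  If
   u <= 1 somewhere in B_{1/4}, every vertex x in B_{1/4} yields a contact point
   y well inside B_1 with u y <= 9; when u > 9 around x the contact is away from
   the vertex, where the cusp has a large gradient and, by concavity of t^(1/4),
   lies above a paraboloid that touches u at y.  The equation then makes y |-> x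
   locally Lipschitz with a universal constant, without any differentiability of
   u: if two touching paraboloids had very different gradients p, p' at nearby
   points, the function
     weighted mean of p and p' + a (D/rho) (component along p' - p)^2
                               - b (D/rho) |.|^2,    D = |p' - p|,
   slid below u would be a strict subsolution with a large gradient.  Hence on a
   fine grid the cells meeting contact points, all in {u <= 9}, carry at least a
   fixed fraction of the measure of the vertices. *)
Require Import Defs.
From HB Require Import structures.
From mathcomp Require Import all_boot all_order all_algebra.
From mathcomp Require Import all_classical all_reals all_analysis.
From mathcomp Require Import ring lra.
Import Order.TTheory GRing.Theory Num.Theory.
Import numFieldNormedType.Exports.

Local Open Scope classical_set_scope.
Local Open Scope ring_scope.

(** * Euclidean inner product and norm, and the topology they induce *)

Section Euclidean.
Context {R : realType} {d : nat}.
Implicit Types (x y z : 'rV[R]_d) (k r c : R).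

Definition dot x y : R := \sum_(i < d) x ord0 i * y ord0 i.

Lemma dotC x y : dot x y = dot y x.
Proof. by apply: eq_bigr => i _; rewrite mulrC. Qed.

Lemma dotDl x y z : dot (x + y) z = dot x z + dot y z.
Proof. by rewrite /dot -big_split; apply: eq_bigr => i _; rewrite mxE mulrDl. Qed.

Lemma dotZl k x z : dot (k *: x) z = k * dot x z.
Proof. by rewrite /dot mulr_sumr; apply: eq_bigr => i _; rewrite mxE mulrA. Qed.

Lemma dotDr x y z : dot z (x + y) = dot z x + dot z y.
Proof. by rewrite dotC dotDl !(dotC z). Qed.

Lemma dotZr k x z : dot z (k *: x) = k * dot z x.
Proof. by rewrite dotC dotZl (dotC z). Qed.

Lemma dotNl x z : dot (- x) z = - dot x z.
Proof. by rewrite -scaleN1r dotZl mulN1r. Qed.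

Lemma dotNr x z : dot z (- x) = - dot z x.
Proof. by rewrite dotC dotNl dotC. Qed.

Definition dotE := (dotDl, dotDr, dotNl, dotNr, dotZl, dotZr).

Lemma dot_delta x i : dot x (delta_mx ord0 i) = x ord0 i.
Proof.
rewrite /dot (bigD1 i)//= big1 ?addr0 => [|j ji]; first by rewrite mxE !eqxx mulr1.
by rewrite mxE (negbTE ji) andbF mulr0.
Qed.

Lemma dot_ge0 x : 0 <= dot x x.
Proof. by apply: sumr_ge0 => i _; rewrite -expr2 sqr_ge0. Qed.

Lemma enormE x : enorm x = Num.sqrt (dot x x).
Proof. by congr Num.sqrt; apply: eq_bigr => i _; rewrite expr2. Qed.

Lemma enorm_ge0 x : 0 <= enorm x. Proof. exact: sqrtr_ge0. Qed.

Lemma sqr_enorm x : enorm x ^+ 2 = dot x x.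
Proof. by rewrite enormE sqr_sqrtr// dot_ge0. Qed.

Lemma coord_le_enorm x i : `|x ord0 i| <= enorm x.
Proof.
rewrite -(ler_pXn2r (ltn0Sn 1)) ?nnegrE ?enorm_ge0//.
rewrite sqr_enorm real_normK ?num_real// /dot (bigD1 i)//= expr2 lerDl.
by apply: sumr_ge0 => j _; rewrite -expr2 sqr_ge0.
Qed.

Lemma enorm_eq0 x : enorm x = 0 -> x = 0.
Proof.
move=> x0; apply/rowP => i; rewrite mxE; apply/eqP.
by rewrite -normr_eq0 eq_le normr_ge0 -x0 coord_le_enorm.
Qed.

Lemma enorm0 : enorm (0 : 'rV[R]_d) = 0.
Proof. by rewrite enormE -(scale0r (0 : 'rV_d)) dotZl mul0r sqrtr0. Qed.

Lemma enormZ k x : enorm (k *: x) = `|k| * enorm x.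
Proof. by rewrite !enormE !dotE mulrA -expr2 sqrtrM ?sqr_ge0// sqrtr_sqr. Qed.

Lemma enormN x : enorm (- x) = enorm x.
Proof. by rewrite -scaleN1r enormZ normrN1 mul1r. Qed.

Lemma dot_le x y : dot x y <= enorm x * enorm y.
Proof.
have := enorm_ge0 x; have := enorm_ge0 y.
have [/enorm_eq0 -> _ _|y0 yge xge] := eqVneq (enorm y) 0.
  by rewrite -(scale0r (0 : 'rV_d)) dotZr enormZ normr0 !mul0r mulr0.
have [/enorm_eq0 ->|x0] := eqVneq (enorm x) 0.
  by rewrite -(scale0r (0 : 'rV_d)) dotZl enormZ normr0 !mul0r.
(* This square equals [2 |x| |y| (|x| |y| - dot x y)]. *)
have := dot_ge0 (enorm y *: x - enorm x *: y).
rewrite !dotE (dotC y x) -!sqr_enorm => H.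
have yp : 0 < enorm y by rewrite lt_neqAle eq_sym y0.
have xp : 0 < enorm x by rewrite lt_neqAle eq_sym x0.
have xyp : 0 < enorm x * enorm y by rewrite mulr_gt0.
by rewrite -(ler_pM2l xyp); lra.
Qed.

Lemma dot_norm_le x y : `|dot x y| <= enorm x * enorm y.
Proof. by rewrite ler_norml dot_le andbT lerNl -dotNl -enormN dot_le. Qed.

Lemma enormD x y : enorm (x + y) <= enorm x + enorm y.
Proof.
rewrite -(ler_pXn2r (ltn0Sn 1)) ?nnegrE ?addr_ge0 ?enorm_ge0//.
rewrite sqr_enorm !dotE -!sqr_enorm (dotC y x).
by have := dot_le x y; lra.
Qed.

Lemma enormB x y : enorm (x - y) = enorm (y - x).
Proof. by rewrite -enormN opprB. Qed.

Lemma enorm_dist x y : enorm x - enorm y <= enorm (x - y).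
Proof. by have := enormD (x - y) y; rewrite subrK; lra. Qed.

Lemma enorm_le_coord x c : (forall i, `|x ord0 i| <= c) -> enorm x <= d%:R * c.
Proof.
move=> xc; have [d0|dp] := posnP d.
  have -> : x = 0 by apply/rowP => i; exfalso; move: (ltn_ord i); rewrite {2}d0.
  by rewrite enorm0 d0 mul0r.
have c0 : 0 <= c by apply: le_trans (xc (Ordinal dp)).
have d1 : 1 <= d%:R :> R by rewrite (ler_nat R 1).
rewrite -(ler_pXn2r (ltn0Sn 1)) ?nnegrE ?enorm_ge0 ?mulr_ge0//.
rewrite sqr_enorm (@le_trans _ _ (\sum_(i < d) c ^+ 2))//.
  apply: ler_sum => i _; rewrite -expr2 -real_normK ?num_real//.
  by rewrite ler_pXn2r ?nnegrE.
rewrite sumr_const card_ord -[leLHS]mulr_natl exprMn ler_wpM2r ?sqr_ge0// expr2.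
by rewrite ler_peMr// ler0n.
Qed.

Lemma enorm_le_norm x : enorm x <= d%:R * `|x|.
Proof.
apply: enorm_le_coord => i; rewrite [leRHS]/Num.norm/= mx_normrE.
by apply/bigmax_geP; right; exists (ord0, i).
Qed.

Lemma norm_le_enorm x : `|x| <= enorm x.
Proof.
rewrite [leLHS]/Num.norm/= mx_normrE; apply/bigmax_leP; split=> [|[i j] _].
  exact: enorm_ge0.
by rewrite (ord1 i) coord_le_enorm.
Qed.

Lemma enorm_nbhsP x (A : set 'rV[R]_d) : 
  nbhs x A <-> exists2 e, 0 < e & forall z, enorm (z - x) < e -> A z.
Proof.
split.
  move=> /nbhs_ballP[e /= e0 eA]; exists e => // z zx; apply: eA.
  rewrite -ball_normE /ball_/= distrC.
  exact: le_lt_trans (norm_le_enorm _) zx.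
(* Dividing by [d.+1] rather than [d] keeps the radius positive when [d = 0]. *)
case=> e e0 eA; apply/nbhs_ballP; exists (e / d.+1%:R) => /= [|z].
  by rewrite divr_gt0.
rewrite -ball_normE /ball_/= distrC ltr_pdivlMr// => zx; apply: eA.
apply: le_lt_trans zx; rewrite (le_trans (enorm_le_norm _))// mulrC.
by rewrite ler_wpM2l// ler_nat.
Qed.

Lemma enorm_cont y : continuous (fun z => enorm (z - y)).
Proof.
move=> x; apply/(@cvgrPdist_lt _ _ _ (nbhs x)) => e e0; apply/enorm_nbhsP; exists e => // z.
apply: le_lt_trans; rewrite ler_norml.
have -> : z - x = (z - y) - (x - y) by rewrite opprB addrA subrK.
have := enorm_dist (z - y) (x - y); have := enorm_dist (x - y) (z - y).
by rewrite (enormB (x - y)) => ? ?; apply/andP; split; lra.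
Qed.

Lemma eball_open r : open (@eball R d r).
Proof.
rewrite openE => x xr; apply/enorm_nbhsP; exists (r - enorm x).
  by rewrite subr_gt0.
by move=> z; rewrite /eball /=; have := enorm_dist z x; lra.
Qed.

Lemma compact_cball y r : compact [set z : 'rV[R]_d | enorm (z - y) <= r].
Proof.
apply: bounded_closed_compact.
  exists (r + enorm y); split=> [|M rM z /= zr]; first by rewrite num_real.
  apply: le_trans (norm_le_enorm _) _; apply: ltW; apply: le_lt_trans rM.
  by have := enorm_dist z y; lra.
have := closed_comp (fun z _ => @enorm_cont y z) (@closed_le R r).
exact.
Qed.

End Euclidean.

(** * Quadratic test functions and the operator on their Hessians *)

Section Quadratic.
Context {R : realType} {d : nat}.
Implicit Types (x y z v P e : 'rV[R]_d) (a b c : R).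

(** Value [c] and gradient [P] at [y]. For a unit vector [e] the Hessian has eigenvalue [2 (a - b)]
    along [e] and [- 2 b] on the orthogonal complement. *)
Definition quad c P e a b y z : R :=
  c + dot P (z - y) + (a * dot e (z - y) ^+ 2 - b * dot (z - y) (z - y)).

Definition quad_grad P e a b y z : 'rV[R]_d :=
  P + (2 * a * dot e (z - y)) *: e - (2 * b) *: (z - y).

(** The difference quotient along [v] is exactly [a + h b]; this yields the gradient and the Hessian
    of [quad] without a chain rule. *)
Lemma derive_quadratic (f : 'rV[R]_d -> R) x v a b :
  (forall h : R, f (h *: v + x) = f x + h * a + h ^+ 2 * b) -> 'D_v f x = a.
Proof.
move=> fE; rewrite /derive; apply: cvg_lim => //.
have H : (fun h : R => a + h * b) h @[h --> 0^'] --> a + 0 * b.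
  apply: cvgD; first exact: cvg_cst.
  by apply: cvgMl; apply: cvg_within_filter; exact: cvg_id.
rewrite mul0r addr0 in H; apply: cvg_trans H; apply: near_eq_cvg.
near=> h => /=; rewrite fE.
have h0 : h != 0 by near: h; exact: nbhs_dnbhs_neq.
by rewrite /GRing.scale/=; field.
Unshelve. all: by end_near. Qed.

Lemma differentiable_dot P y x :
  differentiable (fun z => dot P (z - y) : R) x.
Proof.
have -> : (fun z => dot P (z - y) : R) =
    \sum_(i < d) (P ord0 i *: ((fun z => z ord0 i : R) - cst (y ord0 i))).
  apply/funext => z; rewrite fct_sumE; apply: eq_bigr => i _.
  by rewrite !mxE.
apply: differentiable_sum => i; apply: differentiableZ.
by apply: differentiableB; [exact: differentiable_coord|exact: differentiable_cst].
Qed.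

Lemma differentiable_quad c P e a b y x : differentiable (quad c P e a b y) x.
Proof.
have -> : quad c P e a b y = cst c + (fun z => dot P (z - y))
    + (a *: ((fun z => dot e (z - y)) * (fun z => dot e (z - y)))
       - b *: \sum_(i < d) ((fun z => dot (delta_mx ord0 i) (z - y))
                            * (fun z => dot (delta_mx ord0 i) (z - y)))).
  apply/funext => z; rewrite /quad expr2.
  rewrite /GRing.add /GRing.scale /= /GRing.opp /= fct_sumE.
  congr (_ + (_ - _ * _)); apply: eq_bigr => i _.
  by rewrite /GRing.mul /= !(dotC (delta_mx _ _)) !dot_delta.
apply: differentiableD; first apply: differentiableD.
- exact: differentiable_cst.
- exact: differentiable_dot.
- apply: differentiableB; apply: differentiableZ.
    by apply: differentiableM; exact: differentiable_dot.
  by apply: differentiable_sum => i; apply: differentiableM; exact: differentiable_dot.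
Qed.

Lemma grad_quad c P e a b y : grad (quad c P e a b y) = quad_grad P e a b y.
Proof.
apply/funext => x; apply/rowP => i; rewrite mxE.
apply: (@derive_quadratic _ _ _ _ (a * e ord0 i ^+ 2 - b)) => h.
rewrite /quad -[_ + x - y]addrA /quad_grad; set w := x - y.
rewrite !(dotDl, dotDr, dotZl, dotZr) !(dotC (delta_mx _ _)) !dot_delta !mxE !eqxx /=.
have -> : (0 : 'I_1) = ord0 by [].
by ring.
Qed.

Lemma differentiable_quad_grad P e a b y x :
  differentiable (quad_grad P e a b y) x.
Proof.
have -> : quad_grad P e a b y = cst P + (fun z => (2 * a * dot e (z - y)) *: e)
   - (2 * b) *: (id - cst y).
  by apply/funext.
apply: differentiableB; first apply: differentiableD.
- exact: differentiable_cst.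
- apply: differentiableZl.
  have -> : (fun z => 2 * a * dot e (z - y)) = (2 * a) *: (fun z => dot e (z - y)).
    by apply/funext.
  by apply: differentiableZ; exact: differentiable_dot.
- apply: differentiableZ; apply: differentiableB; last exact: differentiable_cst.
  by have [] := is_diff_id x.
Qed.

Definition quad_hess e a b : 'M[R]_d := (2 * a) *: (e^T *m e) - (2 * b)%:M.

Lemma hess_quad c P e a b y : hess (quad c P e a b y) = cst (quad_hess e a b).
Proof.
apply/funext => x; apply/matrixP => i j; rewrite mxE grad_quad.
apply: (@derive_quadratic _ _ _ _ 0) => h; rewrite mulr0 addr0.
have -> : h *: delta_mx ord0 i + x = x + h *: delta_mx ord0 i by rewrite addrC.
rewrite /quad_grad addrAC !dotE dot_delta /quad_hess /= !mxE big_ord1 !mxE eqxx /= eq_sym.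
by case: eqVneq => _ /=; ring.
Qed.

Lemma C2_quad c P e a b y x : C2_near (quad c P e a b y) x.
Proof.
apply: filterE => z; split; first exact: differentiable_quad.
  by rewrite grad_quad; exact: differentiable_quad_grad.
by rewrite hess_quad; exact: cst_continuous.
Qed.

Lemma psdmxZ (X : 'M[R]_d) c : 0 <= c -> psdmx X -> psdmx (c *: X).
Proof.
move=> c0 [Xt X0]; split; first by rewrite linearZ /= Xt.
by move=> v; rewrite -scalemxAr -scalemxAl mxE mulr_ge0.
Qed.

Lemma form_rank1 e v : (v *m (e^T *m e) *m v^T) ord0 ord0 = dot e v ^+ 2.
Proof.
have ve : (v *m e^T) ord0 ord0 = dot e v.
  by rewrite mxE; apply: eq_bigr => i _; rewrite mxE mulrC.
have ev : (e *m v^T) ord0 ord0 = dot e v.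
  by rewrite mxE; apply: eq_bigr => i _; rewrite mxE.
by rewrite mulmxA -mulmxA mxE big_ord1 ve ev expr2.
Qed.

(** The Hessian is [2 (a - b)] times the projection onto [e] minus [2 b] times the complementary
    projection. These pieces are positive semidefinite with product zero, hence are the positive and
    negative parts by uniqueness; the projections have traces [1] and [d - 1]. *)
Lemma Mminus_quad (lambda Lambda gamma : R) e a b p :
  dot e e = 1 -> 0 <= b -> b <= a -> gamma <= enorm p ->
  Mminus lambda Lambda gamma (quad_hess e a b) p =
  (2 * (lambda * (a - b) - Lambda * b * (d%:R - 1)) - Lambda * enorm p)%:E.
Proof.
move=> e1 b0 ba gp; rewrite /Mminus gp.
have ete : e *m e^T = 1%:M.
  apply/matrixP => i j; rewrite !ord1 !mxE eqxx -e1.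
  by apply: eq_bigr => k _; rewrite !mxE.
have EE : (e^T *m e) *m (e^T *m e) = e^T *m e.
  by rewrite mulmxA -(mulmxA _ e) ete mulmx1.
have psdE : psdmx (e^T *m e).
  split=> [|v]; first by rewrite trmx_mul trmxK.
  by rewrite form_rank1 sqr_ge0.
have psdF : psdmx (1%:M - e^T *m e).
  split=> [|v]; first by rewrite linearB /= trmx1 trmx_mul trmxK.
  rewrite mulmxBr mulmxBl mxE [X in _ + X]mxE form_rank1 mulmx1.
  have -> : (v *m v^T) ord0 ord0 = dot v v.
    by rewrite mxE; apply: eq_bigr => i _; rewrite mxE.
  have := dot_norm_le e v; rewrite (enormE e) e1 sqrtr1 mul1r => H.
  by rewrite subr_ge0 -sqr_enorm -real_normK ?num_real// ler_pXn2r ?nnegrE ?enorm_ge0.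
have pn : posneg_parts (quad_hess e a b)
    ((2 * (a - b)) *: (e^T *m e), (2 * b) *: (1%:M - e^T *m e)).
  split=> /=.
  - by apply: psdmxZ => //; rewrite mulr_ge0 ?subr_ge0.
  - by apply: psdmxZ => //; rewrite mulr_ge0.
  - apply/matrixP => i j; rewrite !mxE big_ord1 !mxE.
    by case: eqVneq => _ /=; ring.
  - by rewrite -scalemxAl -scalemxAr mulmxBr mulmx1 EE subrr !scaler0.
have sym : (quad_hess e a b)^T = quad_hess e a b.
  by rewrite /quad_hess linearB linearZ /= trmx_mul trmxK tr_scalar_mx.
have [-> ->] := posneg_parts_unique (posneg_partsP sym) pn.
rewrite !mxtraceZ [\tr (_ - _)]raddfB /= mxtrace1.
have -> : \tr (e^T *m e) = 1.
  by rewrite mxtrace_mulC ete mxtrace1.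
by congr EFin; ring.
Qed.

End Quadratic.

(** * Minima of lower semicontinuous functions on compact sets *)

Section Minimum.
Context {R : realType}.

Definition lsc_at {T : topologicalType} (f : T -> R) (x : T) : Prop :=
  forall a, a < f x -> \forall y \near x, a < f y.

Lemma lsc_atD {T : topologicalType} (f g : T -> R) (x : T) :
  lsc_at f x -> {for x, continuous g} -> lsc_at (f \+ g) x.
Proof.
move=> lf cg a /= afg; pose e := (f x + g x - a) / 2.
have e0 : 0 < e by rewrite divr_gt0// subr_gt0.
have /lf nf : f x - e < f x by rewrite ltrBlDr ltrDl.
have ng : \forall y \near x, g x - e < g y.
  by apply: (cvgr_gt (g x) cg); rewrite ltrBlDr ltrDl.
by apply: filterS2 nf ng => y /=; rewrite /e; lra.
Qed.

Lemma compact_lsc_min {T : topologicalType} (f : T -> R) (K : set T) :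
  compact K -> K !=set0 -> (forall x, K x -> lsc_at f x) ->
  exists2 c, K c & forall x, K x -> f c <= f x.
Proof.
move=> cK [k Kk] lf; apply: contrapT => nmin.
have {}nmin c : K c -> exists2 x, K x & f x < f c.
  move=> Kc; apply: contrapT => H; apply: nmin; exists c => // x Kx.
  by rewrite leNgt; apply/negP => xc; apply: H; exists x.
(* Compactness applied to the filter of the sublevel sets. *)
pose F := filter_from K (fun x => K `&` [set y | f y <= f x]).
have FF : ProperFilter F.
  apply: filter_from_proper; last by move=> x Kx; exists x; split => /=.
  apply: filter_from_filter; first by exists k.
  move=> x y Kx Ky; have [xy|/ltW yx] := leP (f x) (f y).
    by exists x => // z [Kz /= zx]; do !split => //=; exact: le_trans xy.
  by exists y => // z [Kz /= zx]; do !split => //=; exact: le_trans yx.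
have FK : F K by exists k => // x [].
have [c [Kc clc]] := cK F FF FK.
have [x Kx xc] := nmin c Kc.
(* Lower semicontinuity gives [f > f x] near [c], yet [c] is a cluster point of the set where
   [f <= f x]. *)
have [z [[_ /= zx] /=]] := clc _ _ (ex_intro2 _ _ x Kx (fun _ => id)) (lf c Kc _ xc).
by rewrite ltNge zx.
Qed.

End Minimum.

(** * Gradients of paraboloids touching at nearby points *)

Section Touching.
Context {R : realType} {d : nat}.
Implicit Types (u : 'rV[R]_d -> R) (x y z p : 'rV[R]_d).

Definition touched_below (u : 'rV[R]_d -> R) (L : R) (p y : 'rV[R]_d) : Prop :=
  forall z, eball 1 z -> u y + dot p (z - y) - L * enorm (z - y) ^+ 2 <= u z.

Lemma quad_continuous c P e a b y : continuous (@quad R d c P e a b y).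
Proof. by move=> x; apply: differentiable_continuous; exact: differentiable_quad. Qed.

(** The means with weights 1/3 and 2/3 differ by [(p' - p) / 3], so they cannot both be shorter than
    [|p' - p| / 6]. *)
Lemma convex_weight p p' :
  exists2 t : R, 1 / 3 <= t <= 2 / 3 &
    enorm (p' - p) <= 6 * enorm (p + t *: (p' - p)).
Proof.
have H : enorm (p' - p) / 3 <=
    enorm (p + (1 / 3) *: (p' - p)) + enorm (p + (2 / 3) *: (p' - p)).
  rewrite [leRHS]addrC -(enormN (p + (1/3) *: _)).
  apply: le_trans (enormD _ _).
  have -> : p + (2 / 3) *: (p' - p) - (p + (1 / 3) *: (p' - p)) = (1 / 3) *: (p' - p).
    by apply/rowP => i; rewrite !mxE; field.
  by rewrite enormZ ger0_norm; lra.
have [h|h] := leP (enorm (p' - p)) (6 * enorm (p + (1 / 3) *: (p' - p))).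
  by exists (1 / 3) => //; apply/andP; split; lra.
exists (2 / 3); first by apply/andP; split; lra.
by lra.
Qed.

(* [rho] is the radius on which the strict subsolution beats the maximum of the
   two paraboloids at the boundary, and [t] keeps the mean gradient away from 0
   even if p' = - p. *)
Lemma touching_gradients (lambda Lambda : R) :
  0 < lambda -> lambda <= Lambda ->
  exists C k : R, [/\ 0 < C, 0 < k &
    forall gamma u y y' p p' (L r : R),
    lsc_in (eball 1) u -> visc_Mminus_le lambda Lambda gamma 1 (eball 1) u ->
    0 < r -> 0 <= L -> enorm (y' - y) <= r ->
    enorm y + k * r < 1 -> eball 1 y' -> 10 * gamma <= enorm p ->
    touched_below u L p y -> touched_below u L p' y' ->
    enorm (p' - p) <= C * r * (L + 1 + enorm p + enorm p')].
Proof.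
move=> l0 lL; have L0 : 0 < Lambda by exact: lt_le_trans lL.
(* Small enough that [18 a < 1/2]: the gradient of the test function then stays within [|P| / 2] of
   [P]. *)
pose a : R := 1 / 48.
have den0 : 0 < lambda + Lambda * d%:R by rewrite ltr_pwDl// mulr_ge0// ltW.
(* The concavity [b] costs only half of what the convexity [a] along [e] contributes to the
   operator. *)
pose b : R := lambda * a / (2 * (lambda + Lambda * d%:R)).
have bE : b * (lambda + Lambda * d%:R) = lambda * a / 2.
  by rewrite /b; field; rewrite gt_eqF.
have aE : a = 1 / 48 by [].
have a0 : 0 < a by rewrite aE; lra.
have b0 : 0 < b by rewrite /b divr_gt0// mulr_gt0.
have ba : b <= a / 2.
  have : b * lambda <= a / 2 * lambda.
    have : 0 <= b * (Lambda * d%:R).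
      exact: mulr_ge0 (ltW b0) (mulr_ge0 (ltW L0) (ler0n _ _)).
    by move: bE; rewrite mulrDr; lra.
  by rewrite ler_pM2r.
(* [C1] lets half of the boundary drop [D b rho] absorb the paraboloid errors [5 L rho^2]; [C2]
   makes [lambda D a / rho] exceed the right-hand side 1 plus the gradient term. *)
clearbody b; clearbody a; pose C1 := 20 / b ^+ 2; pose C2 := 2 / (lambda * a * b) * (1 + 2 * Lambda).
have C10 : 0 < C1 by rewrite divr_gt0// exprn_gt0.
have C20 : 0 < C2.
  apply: mulr_gt0; last by lra.
  by apply: divr_gt0 => //; do 2![apply: mulr_gt0 => //].
exists (C1 + C2), (2 / b); split; [by rewrite addr_gt0|by rewrite divr_gt0|].
move=> gamma u y y' p p' L r /(lsc_inP _ (eball_open 1)) lu vu r0 Lge0 ky yr y'1 pg ty ty'.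
have [D DE] : exists D, D = enorm (p' - p) by eexists.
rewrite -DE leNgt; apply/negP => HD.
have [S SE] : exists S, S = enorm p + enorm p' by eexists.
have S0 : 0 <= S by rewrite SE addr_ge0 ?enorm_ge0.
have p0 := enorm_ge0 p; have p'0 := enorm_ge0 p'.
have D00 : 0 <= D by rewrite DE enorm_ge0.
have D0 : 0 < D.
  apply: le_lt_trans HD; rewrite !mulr_ge0 ?addr_ge0//; exact: ltW.
have [C1r C2r] : 0 <= C1 * r /\ 0 <= C2 * r by split; apply: mulr_ge0; exact: ltW.
have HD1 : C1 * r * L < D.
  apply: le_lt_trans HD; apply: ler_pM => //; last by lra.
  by rewrite ler_pM2r// lerDl ltW.
have HD2 : C2 * r * (1 + S) < D.
  apply: le_lt_trans HD; apply: ler_pM => //; last by rewrite SE; lra.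
    by lra.
  by rewrite ler_pM2r// lerDr ltW.
(* With this radius the cost [D r] of the second paraboloid being centred at [y'] is the other half
   of [D b rho]. *)
pose rho := 2 / b * r.
have rho0 : 0 < rho by rewrite mulr_gt0// divr_gt0.
have rE : r = b * rho / 2 by rewrite /rho; field; rewrite gt_eqF.
have rhoE : rho = 2 / b * r by [].
clearbody rho.
have rrho : r <= rho.
  by rewrite rE -mulrA mulrCA ler_piMr ?ltW//; move: ba; rewrite aE; lra.
have HD1' : 5 * L * rho ^+ 2 < D * b * rho / 2.
  have -> : 5 * L * rho ^+ 2 = (C1 * r * L) * (b * rho / 2).
    by rewrite /C1 [in RHS]rE; field; rewrite gt_eqF.
  have -> : D * b * rho / 2 = D * (b * rho / 2) by ring.
  by rewrite ltr_pM2r// divr_gt0// mulr_gt0.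
have HD2' : 1 + Lambda * (2 * S) < D * lambda * a / rho.
  have : C2 * r * (1 + S) * (lambda * a / rho) < D * (lambda * a / rho).
    by rewrite ltr_pM2r// divr_gt0// mulr_gt0.
  have -> : C2 * r * (1 + S) * (lambda * a / rho) = (1 + 2 * Lambda) * (1 + S).
    by rewrite /C2 {1}rE; field; rewrite !gt_eqF.
  have : 0 <= Lambda * S by rewrite mulr_ge0// ltW.
  by move: S0 L0; rewrite !mulrA; clear; lra.
have [t /andP[t1 t2] tP] := convex_weight p p'.
set P := p + t *: (p' - p) in tP.
rewrite -DE in tP.
pose e := D^-1 *: (p' - p).
have eD z : D * dot e z = dot (p' - p) z.
  by rewrite /e dotZl mulrA divff ?mul1r// gt_eqF.
have e1 : dot e e = 1.
  rewrite /e dotZl dotZr -sqr_enorm -DE; field; by rewrite gt_eqF.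
have en1 : enorm e = 1 by rewrite enormE e1 sqrtr1.
clearbody e.
pose A := D * a / rho; pose B := D * b / rho.
have A0 : 0 < A by rewrite divr_gt0// mulr_gt0.
have B0 : 0 < B by rewrite divr_gt0// mulr_gt0.
have AE : A = D * a / rho by [].
have BE : B = D * b / rho by [].
have BA : B <= A.
  by rewrite ler_pM2r ?invr_gt0// ler_pM2l//; move: ba a0; clear; lra.
clearbody A B; pose psi := quad (u y) P e A B y.
have y1 z : enorm (z - y) <= rho -> eball 1 z.
  rewrite /eball /= => zr; have := enormD (z - y) y; rewrite subrK.
  by move: yr zr; rewrite -rhoE; clear; lra.
have tyd z : enorm (z - y) <= rho ->
    u y + dot p (z - y) - L * rho ^+ 2 <= u z.
  move=> zr; apply: le_trans (ty z (y1 z zr)).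
  by rewrite lerD2l lerN2 ler_wpM2l// lerXn2r ?nnegrE ?enorm_ge0// ltW.
(* The second paraboloid recentred at [y]. The first one bounds [u y'] from below with error
   [L rho^2]; the second adds [4 L rho^2] because [|z - y'| <= 2 rho]. *)
have tyd' z : enorm (z - y) <= rho ->
    u y + dot p (z - y) + D * dot e (z - y) - D * r - 5 * L * rho ^+ 2 <= u z.
  move=> zr; apply: le_trans (ty' z (y1 z zr)).
  have H1 := tyd y' (le_trans ky rrho).
  have H2 : enorm (z - y') ^+ 2 <= (2 * rho) ^+ 2.
    apply: lerXn2r; rewrite ?nnegrE ?enorm_ge0//; first by rewrite mulr_ge0// ltW.
    have -> : z - y' = (z - y) + (y - y') by rewrite addrA subrK.
    by have := enormD (z - y) (y - y'); move: zr ky rrho; rewrite (enormB y); clear; lra.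
  have H3 : L * enorm (z - y') ^+ 2 <= L * (2 * rho) ^+ 2 by rewrite ler_wpM2l.
  have H4 : dot (p' - p) (y' - y) <= D * r.
    by apply: le_trans (dot_le _ _) _; rewrite -DE ler_wpM2l.
  have -> : dot p' (z - y') = dot p (z - y) + dot (p' - p) (z - y)
      - dot (p' - p) (y' - y) - dot p (y' - y).
    by rewrite !dotE; ring.
  by rewrite eD; move: H1 H3 H4; rewrite exprMn; clear; lra.
have bdry z : enorm (z - y) = rho -> psi z < u z.
  move=> zr; have zr' : enorm (z - y) <= rho by rewrite zr.
  have := tyd z zr'; have := tyd' z zr'.
  rewrite /psi /quad /P dotDl dotZl -eD -sqr_enorm zr.
  set s := dot e (z - y); set q := dot p (z - y).
  have sr : `|s| <= rho by have := dot_norm_le e (z - y); rewrite en1 mul1r zr.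
  have -> : B * rho ^+ 2 = D * b * rho by rewrite BE; field; rewrite gt_eqF.
  have As : A * s ^+ 2 <= D * (a * `|s|).
    have -> : D * (a * `|s|) = A * (`|s| * rho) by rewrite AE; field; rewrite gt_eqF.
    by rewrite ler_pM2l// -real_normK ?num_real// expr2 ler_wpM2l.
  have Dr : D * r = D * b * rho / 2 by rewrite {1}rE; ring.
  rewrite Dr => h1 h2.
  have Lr0 : 0 <= L * rho ^+ 2 := mulr_ge0 Lge0 (sqr_ge0 _).
  have Dbr : 0 < D * b * rho := mulr_gt0 (mulr_gt0 D0 b0) rho0.
  (* For [s >= 0] the comparison is with the paraboloid of slope [p'], otherwise with that of slope
     [p]. As [t] lies in [1/3, 2/3], the linear gap in [s] dominates [A s^2]. *)
  have [s0|s0] := leP 0 s.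
    have Ds : 0 <= D * s by exact: mulr_ge0 (ltW D0) s0.
    rewrite ger0_norm// in As.
    have : t * (D * s) <= 2 / 3 * (D * s) by rewrite ler_wpM2r.
    by move: As h1 h2 Ds HD1' Lr0 Dbr; rewrite aE; clear; lra.
  have Ds : 0 <= D * - s by apply: mulr_ge0; rewrite ?oppr_ge0 ltW.
  rewrite ltr0_norm// in As.
  have : 1 / 3 * (D * - s) <= t * (D * - s) by rewrite ler_wpM2r.
  by move: As h1 h2 Ds HD1' Lr0 Dbr; rewrite aE; clear; lra.
have [||x0 /= x0r x0min] := @compact_lsc_min R _ (u \- psi) _ (compact_cball y rho).
- by exists y; rewrite /= subrr enorm0 ltW.
- move=> x /= xr; apply: lsc_atD; first by apply: lu; exact: y1.
  by apply: continuousN; exact: quad_continuous.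
have psiy : psi y = u y.
  rewrite /psi /quad subrr -(scale0r (0 : 'rV_d)) !dotZr !mul0r; ring.
(* [u - psi] vanishes at the centre and is positive on the sphere, so the minimum is interior. *)
have x0lt : enorm (x0 - y) < rho.
  rewrite lt_neqAle x0r andbT; apply/negP => /eqP /bdry.
  have := x0min y; rewrite subrr enorm0 => /(_ (ltW rho0)) /=.
  by rewrite psiy; clear; lra.
have locmin : \forall x \near x0, u x0 - psi x0 <= u x - psi x.
  apply/enorm_nbhsP; exists (rho - enorm (x0 - y)); first by rewrite subr_gt0.
  move=> z zx; apply: x0min.
  have -> : z - y = (z - x0) + (x0 - y) by rewrite addrA subrK.
  by have := enormD (z - x0) (x0 - y); move: zx; clear; lra.
have := vu x0 psi (y1 _ x0r) (C2_quad _ _ _ _ _ _ _) locmin.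
rewrite /psi grad_quad hess_quad /cst.
set G := quad_grad P e A B y x0.
have GP : enorm (G - P) <= 18 * a * enorm P.
  have -> : G - P = (2 * A * dot e (x0 - y)) *: e - (2 * B) *: (x0 - y).
    by rewrite /G /quad_grad -[P + _ - _]addrA [P + _]addrC addrK.
  apply: le_trans (enormD _ _) _; rewrite enormN !enormZ en1 mulr1.
  rewrite !normrM !(@ger0_norm _ 2)// (gtr0_norm A0) (gtr0_norm B0).
  have h1 : A * `|dot e (x0 - y)| <= A * rho.
    by rewrite ler_pM2l// (le_trans (dot_norm_le _ _))// en1 mul1r.
  have h2 : B * enorm (x0 - y) <= B * rho by rewrite ler_pM2l.
  have h3 : A * rho = D * a by rewrite AE; field; rewrite gt_eqF.
  have h4 : B * rho = D * b by rewrite BE; field; rewrite gt_eqF.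
  have h5 : D * b <= D * (a / 2) by rewrite ler_pM2l.
  have h6 : D * a <= 6 * enorm P * a by rewrite ler_pM2r.
  clear - h1 h2 h3 h4 h5 h6; lra.
have P0 := enorm_ge0 P.
have G1 : enorm P / 2 <= enorm G.
  have := enorm_dist P G; rewrite (enormB P); move: GP P0; rewrite aE; clear; lra.
have G2 : enorm G <= 2 * enorm P.
  have := enorm_dist G P; move: GP P0; rewrite aE; clear; lra.
(* Since [|p - P| <= 2 D / 3 <= 4 |P|]. With [|G| >= |P| / 2] this gives [|G| >= |p| / 10 >= gamma],
   so the equation is active at [x0]. *)
have P1 : enorm p <= 5 * enorm P.
  have := enorm_dist p P.
  rewrite (enormB p) {2}/P (addrC p) addrK enormZ -DE.
  have td : `|t| * D <= 2 / 3 * D by rewrite ler_pM2r// ger0_norm; move: t1 t2; clear; lra.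
  by rewrite -/P; move: td tP; clear; lra.
have P2 : enorm P <= S.
  have -> : P = (1 - t) *: p + t *: p'.
    by apply/rowP => i; rewrite /P !mxE; ring.
  apply: le_trans (enormD _ _) _; rewrite !enormZ !ger0_norm; [|by move: t1 t2; clear; lra..].
  by rewrite SE; apply: lerD; apply: ler_piMl => //; move: t1 t2; clear; lra.
rewrite Mminus_quad//; [|exact: ltW|by move: pg P1 G1; clear; lra].
rewrite lee_fin leNgt => /negP; apply.
(* Twice this quantity is [lambda A + 2 Lambda B], by the choice of [b]; it exceeds
   [1 + Lambda |G|], contradicting the supersolution property. *)
have h1 : lambda * (A - B) - Lambda * B * (d%:R - 1) =
   D * lambda * a / rho - B * (lambda + Lambda * d%:R) + Lambda * B.
  by rewrite AE; ring.
have h2 : B * (lambda + Lambda * d%:R) = D * lambda * a / rho / 2.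
  have -> : B * (lambda + Lambda * d%:R) = D / rho * (b * (lambda + Lambda * d%:R)).
    by rewrite BE; ring.
  by rewrite bE; ring.
have h3 : 0 <= Lambda * B by rewrite mulr_ge0// ltW.
have h4 : Lambda * enorm G <= Lambda * (2 * S).
  by rewrite ler_pM2l//; move: G2 P2; clear; lra.
by rewrite h1 h2; move: h3 h4 HD2'; clear; lra.
Qed.

End Touching.

(** * Cusps touching from below, and the dependence of vertices on contact points *)

Section Cusp.
Context {R : realType} {d : nat}.
Implicit Types (u : 'rV[R]_d -> R) (x y z v q : 'rV[R]_d) (s t : R).

Definition cusp_touches (u : 'rV[R]_d -> R) (x y : 'rV[R]_d) : Prop :=
  forall z, eball 1 z ->
    u y + 10 * Num.sqrt (enorm (y - x)) <= u z + 10 * Num.sqrt (enorm (z - x)).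

Lemma sqr_enormD x y :
  enorm (x + y) ^+ 2 = enorm x ^+ 2 + 2 * dot x y + enorm y ^+ 2.
Proof. by rewrite !sqr_enorm !dotE (dotC y x); ring. Qed.

(** The cusp is [-10 t^(1/4)] in the squared distance [t] to the vertex. Replacing the concave power
    by its tangent at [s^4] gives a paraboloid below the cusp with the same value and gradient at
    [y]. *)
Lemma cusp_touched_below u x y s : 0 < s -> enorm (y - x) = s ^+ 2 ->
  cusp_touches u x y ->
  touched_below u (5 / (2 * s ^+ 3)) (- (5 / s ^+ 3) *: (y - x)) y.
Proof.
move=> s0 yx H z /H; rewrite yx sqrtr_sqr gtr0_norm//.
set t := Num.sqrt _.
have t0 : 0 <= t := sqrtr_ge0 _.
have t4 : t ^+ 4 = s ^+ 4 + 2 * dot (y - x) (z - y) + enorm (z - y) ^+ 2.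
  have -> : t ^+ 4 = enorm (z - x) ^+ 2.
    by rewrite (exprM t 2 2) sqr_sqrtr ?enorm_ge0.
  have -> : z - x = (y - x) + (z - y) by rewrite [RHS]addrC addrA subrK.
  by rewrite sqr_enormD yx -exprM.
(* Tangent line of t^(1/4) at s^4. *)
have tangent : 4 * (t * s ^+ 3) <= t ^+ 4 + 3 * s ^+ 4.
  have : 0 <= (t - s) ^+ 2 * (t ^+ 2 + 2 * (t * s) + 3 * s ^+ 2).
    by rewrite mulr_ge0 ?sqr_ge0// !addr_ge0 ?mulr_ge0 ?sqr_ge0// ltW.
  by rewrite -subr_ge0; congr (0 <= _); ring.
have : 10 * t <= 10 * s + 5 / s ^+ 3 * dot (y - x) (z - y)
      + 5 / (2 * s ^+ 3) * enorm (z - y) ^+ 2.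
  have -> : 10 * s + 5 / s ^+ 3 * dot (y - x) (z - y)
      + 5 / (2 * s ^+ 3) * enorm (z - y) ^+ 2 =
     10 * (t ^+ 4 + 3 * s ^+ 4) / (4 * s ^+ 3).
    by rewrite t4; field; rewrite gt_eqF.
  have s3 : 0 < 4 * s ^+ 3 by rewrite mulr_gt0// exprn_gt0.
  rewrite ler_pdivlMr// -!mulrA ler_pM2l//.
  by move: tangent; rewrite mulrCA.
by rewrite dotZl mulNr; lra.
Qed.

(* The inverse of the cusp gradient v |-> |v|^(-3/2) v is q |-> |q|^(-3) q. *)
Lemma inv_cusp_gradient v v' s s' (del : R) : 0 < s' -> s' <= s ->
  enorm v = s ^+ 2 -> enorm v' = s' ^+ 2 ->
  enorm ((s ^- 3) *: v - (s' ^- 3) *: v') <= del -> del <= 1 / (2 * s') ->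
  enorm (v - v') <= 22 * s' ^+ 3 * del.
Proof.
move=> s'0 s's; have s0 : 0 < s by exact: lt_le_trans s's.
set q := s ^- 3 *: v; set q' := s' ^- 3 *: v' => vs vs' qd ds.
have normq : enorm q = s^-1.
  rewrite enormZ vs gtr0_norm ?invr_gt0 ?exprn_gt0//; field; by rewrite gt_eqF.
have normq' : enorm q' = s'^-1.
  rewrite enormZ vs' gtr0_norm ?invr_gt0 ?exprn_gt0//; field; by rewrite gt_eqF.
have h1 : s'^-1 - s^-1 <= del.
  by have := enorm_dist q' q; rewrite normq normq' enormB; lra.
have del0 : 0 <= del := le_trans (enorm_ge0 _) qd.
have s2 : s <= 2 * s'.
  have e : 1 / (2 * s') = s'^-1 / 2 by field; rewrite gt_eqF.
  have : (2 * s')^-1 <= s^-1 by rewrite invfM; lra.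
  by rewrite lef_pV2 ?posrE ?mulr_gt0.
have h2 : s - s' <= 2 * del * s' ^+ 2.
  have -> : s - s' = (s'^-1 - s^-1) * (s * s').
    by field; rewrite !gt_eqF.
  have -> : 2 * del * s' ^+ 2 = del * (2 * s' * s') by ring.
  apply: ler_pM => //.
  - by rewrite subr_ge0 lef_pV2 ?posrE.
  - by rewrite mulr_ge0// ltW.
  - by rewrite ler_pM2r.
have s38 : s ^+ 3 <= 8 * s' ^+ 3.
  have -> : 8 * s' ^+ 3 = (2 * s') ^+ 3 by ring.
  by apply: lerXn2r; rewrite ?nnegrE// ltW// mulr_gt0.
have h3 : 0 <= s ^+ 3 - s' ^+ 3 <= 14 * del * s' ^+ 4.
  rewrite subr_ge0 lerXn2r ?nnegrE ?(ltW s0) ?(ltW s'0)//=.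
  have -> : s ^+ 3 - s' ^+ 3 = (s - s') * (s ^+ 2 + s * s' + s' ^+ 2) by ring.
  have -> : 14 * del * s' ^+ 4 = (2 * del * s' ^+ 2) * (7 * s' ^+ 2) by ring.
  apply: ler_pM => //; rewrite ?subr_ge0//.
    by rewrite !addr_ge0 ?sqr_ge0// mulr_ge0// ltW.
  have : s ^+ 2 <= (2 * s') ^+ 2 by apply: lerXn2r; rewrite ?nnegrE// ltW// mulr_gt0.
  have : s * s' <= 2 * s' * s' by rewrite ler_pM2r.
  by rewrite !expr2; lra.
(* The first term contributes [8 s'^3 del] and the second [14 s'^3 del], whence the constant 22. *)
have -> : v - v' = s ^+ 3 *: (q - q') + (s ^+ 3 - s' ^+ 3) *: q'.
  by apply/rowP => i; rewrite /q /q' !mxE; field; rewrite !gt_eqF.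
apply: le_trans (enormD _ _) _; rewrite enormZ (enormZ _ q') normq'.
have /andP[h4 h5] := h3.
rewrite (ger0_norm h4) (@ger0_norm _ (s ^+ 3)) ?exprn_ge0 ?(ltW s0)//.
have h6 : s ^+ 3 * enorm (q - q') <= 8 * s' ^+ 3 * del.
  by apply: ler_pM => //; rewrite ?enorm_ge0// exprn_ge0// ltW.
have h7 : (s ^+ 3 - s' ^+ 3) / s' <= 14 * del * s' ^+ 3.
  rewrite ler_pdivrMr//; apply: le_trans h5 _.
  have -> : 14 * del * s' ^+ 3 * s' = 14 * del * s' ^+ 4 by ring.
  by [].
by lra.
Qed.

(** The competitor [x0] has total at most 81/10, while beyond radius 19/20 the cusp term alone is at
    least 83/10. A minimiser over the closed ball is therefore interior and minimal over all of
    B_1. *)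
Lemma cusp_contact u x0 x : lsc_in (eball 1) u ->
  (forall x, eball 1 x -> 0 <= u x) -> eball (1 / 4) x0 -> u x0 <= 1 ->
  eball (1 / 4) x ->
  exists y, [/\ enorm y < 19 / 20, u y <= 9 & cusp_touches u x y].
Proof.
move=> /(lsc_inP _ (eball_open 1)) lu u0 x0b ux0 xb.
rewrite /eball /= in x0b xb.
pose f z := 10 * Num.sqrt (enorm (z - x)).
have f0 z : 0 <= f z by rewrite mulr_ge0// sqrtr_ge0.
have fcont : continuous f.
  move=> z; have sc : {for z, continuous (@Num.sqrt R \o (fun z => enorm (z - x)))}.
    exact: (continuous_comp (@enorm_cont _ _ x z) (@sqrt_continuous R _)).
  have cc : {for z, continuous (cst 10 : 'rV[R]_d -> R)} by exact: cst_continuous.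
  exact: (continuousM cc sc).
have K1 z : enorm z <= 19 / 20 -> eball 1 z by rewrite /eball/=; lra.
have [||y /= yK ymin] := @compact_lsc_min R _ (u \+ f) _ (compact_cball 0 (19 / 20)).
- by exists 0; rewrite /= subrr enorm0; lra.
- move=> z /=; rewrite subr0 => zK; apply: lsc_atD; last exact: fcont.
  by apply: lu; exact: K1.
rewrite subr0 in yK.
(* [|x0 - x| < 1/2 < (71/100)^2]; for [far] below, [7/10 > (83/100)^2]. *)
have fx0 : f x0 <= 71 / 10.
  have : Num.sqrt (enorm (x0 - x)) <= Num.sqrt ((71 / 100) ^+ 2).
    rewrite ler_sqrt; last by lra.
    by have := enormD x0 (- x); rewrite enormN; lra.
  by rewrite sqrtr_sqr ger0_norm /f; lra.
have far z : 19 / 20 <= enorm z -> 83 / 10 <= f z.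
  move=> z1; have : Num.sqrt ((83 / 100) ^+ 2) <= Num.sqrt (enorm (z - x)).
    rewrite ler_sqrt ?enorm_ge0//.
    by have := enorm_dist z x; lra.
  by rewrite sqrtr_sqr ger0_norm /f; lra.
have yx0 : u y + f y <= u x0 + f x0.
  by apply: ymin; rewrite subr0; lra.
have uy0 := u0 y (K1 y yK).
exists y; split.
- by rewrite ltNge; apply/negP => /far; lra.
- by have := f0 y; lra.
move=> z z1; rewrite -/(f y) -/(f z).
have [zK|/ltW/far zfar] := leP (enorm z) (19 / 20).
  by have := ymin z; rewrite subr0 => /(_ zK).
by have := u0 z z1; lra.
Qed.

(** [touching_gradients] compares the cusp gradients at [y] and [y'], and inverting the cusp
    gradient recovers the vertices. The opening of order [s^-3] blows up near the vertex, but the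
    inverse gradient contracts by [s^3]: hence [C] is independent of [eta], which only limits
    [r]. *)
Lemma vertex_lipschitz (lambda Lambda : R) :
  0 < lambda -> lambda <= Lambda ->
  exists C c : R, [/\ 0 < C, 0 < c &
    forall gamma u x y x' y' (eta r : R),
    gamma <= 1 / 10 ->
    lsc_in (eball 1) u -> visc_Mminus_le lambda Lambda gamma 1 (eball 1) u ->
    eball (1 / 4) x -> eball (1 / 4) x' ->
    enorm y < 19 / 20 -> enorm y' < 19 / 20 ->
    cusp_touches u x y -> cusp_touches u x' y' ->
    0 < eta -> eta <= enorm (y - x) -> eta <= enorm (y' - x') ->
    0 < r -> r <= c -> r <= c * eta -> enorm (y' - y) <= r ->
    enorm (x' - x) <= C * r].
Proof.
move=> l0 lL; have [C [k [C0 k0 H]]] := @touching_gradients R d _ _ l0 lL.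
(* 140 bounds [22 * 31 / 5], and the 1 accounts for [y' - y]. The bound [1 / (20 k)] keeps the ball
   of radius [k r] about [y] inside B_1; [1 / (13 C)] serves the smallness condition on [del]. *)
exists (1 + 140 * C), (Num.min (1 / (13 * C)) (1 / (20 * k))); split.
- by lra.
- by rewrite lt_min !divr_gt0// mulr_gt0.
move=> gamma u x y x' y' eta r g1 lu vu xb xb' yb yb' cxy cxy' eta0 exy exy' r0.
set c := Num.min _ _ => rc rce yyr.
have c0 : 0 < c by rewrite lt_min !divr_gt0// mulr_gt0.
rewrite /eball /= in xb xb'.
pose s := Num.sqrt (enorm (y - x)); pose s' := Num.sqrt (enorm (y' - x')).
have sE : enorm (y - x) = s ^+ 2 by rewrite sqr_sqrtr// enorm_ge0.
have sE' : enorm (y' - x') = s' ^+ 2 by rewrite sqr_sqrtr// enorm_ge0.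
have s0 : 0 < s by rewrite sqrtr_gt0 (lt_le_trans eta0).
have s0' : 0 < s' by rewrite sqrtr_gt0 (lt_le_trans eta0).
have small z v : enorm z < 19 / 20 -> enorm v < 1 / 4 ->
    Num.sqrt (enorm (z - v)) <= 3 / 2.
  move=> zb vb; have -> : 3 / 2 = Num.sqrt ((3 / 2) ^+ 2 : R).
    by rewrite sqrtr_sqr ger0_norm//; lra.
  rewrite ler_sqrt; last by lra.
  by have := enormD z (- v); rewrite enormN; lra.
have s1 : s <= 3 / 2 := small _ _ yb xb.
have s1' : s' <= 3 / 2 := small _ _ yb' xb'.
clearbody s s'.
have t := cusp_touched_below _ _ _ _ s0 sE cxy.
have t' := cusp_touched_below _ _ _ _ s0' sE' cxy'.
set p := - (5 / s ^+ 3) *: (y - x) in t.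
set p' := - (5 / s' ^+ 3) *: (y' - x') in t'.
have normp : enorm p = 5 / s.
  rewrite /p enormZ sE normrN gtr0_norm ?divr_gt0 ?exprn_gt0//.
  by field; rewrite gt_eqF.
have normp' : enorm p' = 5 / s'.
  rewrite /p' enormZ sE' normrN gtr0_norm ?divr_gt0 ?exprn_gt0//.
  by field; rewrite gt_eqF.
(* Both paraboloids are weakened to the larger opening, that of the contact closer to its vertex. *)
pose m := Num.min s s'.
have mE : m = s /\ s <= s' \/ m = s' /\ s' <= s.
  by rewrite /m; case: (leP s s') => [|/ltW]; [left|right].
have m0 : 0 < m by rewrite lt_min s0.
have ms : m <= s by rewrite ge_min lexx.
have ms' : m <= s' by rewrite ge_min lexx orbT.
clearbody m.
have weaken L1 p1 y1 : L1 <= 5 / (2 * m ^+ 3) -> touched_below u L1 p1 y1 ->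
    touched_below u (5 / (2 * m ^+ 3)) p1 y1.
  move=> LL T z z1; apply: le_trans (T z z1).
  by rewrite lerD2l lerN2 ler_wpM2r// sqr_ge0.
have Lm a : m <= a -> 5 / (2 * a ^+ 3) <= 5 / (2 * m ^+ 3).
  move=> ma; have a0 : 0 < a by exact: lt_le_trans ma.
  rewrite ler_pM2l// lef_pV2 ?posrE ?mulr_gt0 ?exprn_gt0// ler_pM2l//.
  by apply: lerXn2r; rewrite ?nnegrE// ltW.
have kr : k * r <= 1 / 20.
  have : r <= 1 / (20 * k) by apply: le_trans rc _; rewrite ge_min lexx orbT.
  by rewrite ler_pdivlMr ?mulr_gt0//; clear; lra.
(* Steepness of the cusp: with [gamma <= 1 / 10] this gives [10 gamma <= |p|]. *)
have pbig : 1 <= enorm p.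
  by rewrite normp ler_pdivlMr// mul1r; move: s1; clear; lra.
have := H gamma u y y' p p' (5 / (2 * m ^+ 3)) r lu vu r0.
move=> /(_ _ yyr _ _ _ (weaken _ _ _ (Lm _ ms) t) (weaken _ _ _ (Lm _ ms') t')) D.
(* In units of [m^-3], the opening contributes 5/2, the constant 4 and each gradient 12. *)
have {D} : enorm (p' - p) <= C * r * (31 / m ^+ 3).
  apply: le_trans (D _ _ _ _) _.
  - by rewrite divr_ge0// mulr_ge0// exprn_ge0// ltW.
  - by move: yb kr; clear; lra.
  - by rewrite /eball/=; move: yb'; clear; lra.
  - by move: g1 pbig; clear; lra.
  rewrite ler_pM2l ?mulr_gt0// normp normp'.
  have m1 : m <= 3 / 2 by exact: le_trans ms s1.
  have m2 : m ^+ 2 <= 9 / 4 by rewrite expr2; have := ler_pM (ltW m0) (ltW m0) m1 m1; clear; lra.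
  have m3 : m ^+ 3 <= 27 / 8.
    rewrite exprS; have := ler_pM (ltW m0) (sqr_ge0 m) m1 m2; clear; lra.
  have i a : m <= a -> 5 / a <= 12 / m ^+ 3.
    move=> ma; apply: (@le_trans _ _ (5 / m)).
      by rewrite ler_pM2l// lef_pV2 ?posrE// (lt_le_trans m0).
    rewrite ler_pdivlMr ?exprn_gt0//.
    have -> : 5 / m * m ^+ 3 = 5 * m ^+ 2 by field; rewrite gt_eqF.
    by move: m2; clear; lra.
  have j : 1 <= 4 / m ^+ 3 by rewrite ler_pdivlMr ?exprn_gt0//; move: m3; clear; lra.
  have -> : 5 / (2 * m ^+ 3) = 5 / 2 / m ^+ 3 by field; rewrite gt_eqF.
  by have := i _ ms; have := i _ ms'; move: j; clear; lra.
have ppE : enorm (p' - p) = 5 * enorm (s ^- 3 *: (y - x) - s' ^- 3 *: (y' - x')).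
  have -> : p' - p = 5 *: (s ^- 3 *: (y - x) - s' ^- 3 *: (y' - x')).
    by apply/rowP => i; rewrite /p /p' !mxE; ring.
  by rewrite enormZ ger0_norm.
rewrite ppE => D.
pose del := C * r * (31 / m ^+ 3) / 5.
have {}D : enorm (s ^- 3 *: (y - x) - s' ^- 3 *: (y' - x')) <= del.
  by rewrite /del ler_pdivlMr//; move: D; clear; lra.
(* Here [r <= c eta] enters, through [eta <= m^2]. *)
have delm : del <= 1 / (2 * m).
  have : r <= 1 / (13 * C) * m ^+ 2.
    apply: le_trans rce _; apply: ler_pM.
    - exact: ltW c0.
    - exact: ltW.
    - by rewrite ge_min lexx.
    - by case: mE => -[-> _]; rewrite -?sE -?sE'.
  have -> : 1 / (13 * C) * m ^+ 2 = m ^+ 2 / (13 * C) by ring.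
  rewrite ler_pdivlMr ?mulr_gt0// => rm.
  have -> : 1 / (2 * m) = m ^+ 2 * (1 / (2 * m ^+ 3)) by field; rewrite gt_eqF.
  have -> : del = (C * r * 62 / 5) * (1 / (2 * m ^+ 3)).
    by rewrite /del; field; rewrite gt_eqF.
  rewrite ler_pM2r ?divr_gt0 ?mulr_gt0 ?exprn_gt0//.
  have := sqr_ge0 m; have : 0 < C * r by rewrite mulr_gt0.
  by move: rm; clear; lra.
have mdel : 22 * m ^+ 3 * del = C * r * (22 * 31 / 5).
  by rewrite /del; field; rewrite gt_eqF.
clearbody del.
have key : enorm ((y - x) - (y' - x')) <= 22 * m ^+ 3 * del.
  case: mE => -[mE ss]; rewrite mE in delm *; last first.
    exact: (@inv_cusp_gradient _ _ s s' del).
  by rewrite enormB; apply: (@inv_cusp_gradient _ _ s' s del) => //; rewrite enormB.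
have -> : x' - x = ((y - x) - (y' - x')) + (y' - y).
  by apply/rowP => i; rewrite !mxE; ring.
apply: le_trans (enormD _ _) _.
have : 0 < C * r by rewrite mulr_gt0.
by move: key yyr; rewrite mdel; clear; lra.
Qed.

End Cusp.

(** * Measurability and volume of open sets and their erosions *)

Section Volume.
Context {R : realType} {d : nat}.
Implicit Types (A O : set 'rV[R]_d) (a b : 'I_d -> R).

Definition tuple_set A : set (d.-tuple (measurableTypeR R)) :=
  [set t | A (\row_(i < d) tnth t i)].

Definition box a b : set 'rV[R]_d :=
  [set x | forall i, a i <= x ord0 i <= b i].

Lemma volume_measureP :
  exists mu : {measure set (d.-tuple (measurableTypeR R)) -> \bar R},
    forall A, volume A = mu (tuple_set A).
Proof.
have [mu muE] := lebesgue_tuple_measureP R d.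
by exists mu => A; rewrite /volume muE.
Qed.

Lemma measurable_box a b : measurable (tuple_set (box a b)).
Proof.
have -> : tuple_set (box a b) = \bigcap_(i in [set: 'I_d])
    ((fun t : d.-tuple (measurableTypeR R) => tnth t i) @^-1` `[a i, b i]).
  apply/seteqP; split => t /= H i.
    by move=> _ /=; have := H i; rewrite mxE in_itv.
  by have := H i I; rewrite mxE /= in_itv.
apply: fin_bigcap_measurable => // i _; rewrite -[X in measurable X]setTI.
exact: (@measurable_tnth _ (measurableTypeR R) d i measurableT _ (measurable_itv _)).
Qed.

(** An open set is the countable union of the closed cubes with corners in a lattice of mesh
    [1 / (k + 1)] that it contains. *)
Lemma measurable_open O : open O -> measurable (tuple_set O).
Proof.
move=> oO.
pose B (p : nat * {ffun 'I_d -> int}) :=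
  box (fun j => (p.2 j)%:~R / p.1.+1%:R) (fun j => ((p.2 j)%:~R + 1) / p.1.+1%:R).
have -> : tuple_set O =
    \bigcup_p (if `[< B p `<=` O >] then tuple_set (B p) else set0).
  apply/seteqP; split => [t Ot|t [p _]]; last first.
    by case: ifPn => // /asboolP BO; exact: BO.
  set x := \row_(i < d) tnth t i.
  have /enorm_nbhsP[e e0 eO] : nbhs x O by move: oO; rewrite openE; exact.
  pose k := Num.truncn (d%:R / e).
  have ke : d%:R / k.+1%:R < e.
    by rewrite ltr_pdivrMr// mulrC -ltr_pdivrMr// truncnS_gt.
  pose z : {ffun 'I_d -> int} := [ffun j => Num.floor (x ord0 j * k.+1%:R)].
  have zx : B (k, z) x.
    move=> j /=; rewrite ffunE ler_pdivrMr// ler_pdivlMr//.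
    by have /andP[-> /ltW] := floor_itv (x ord0 j * k.+1%:R); rewrite intrD.
  exists (k, z) => //; case: ifPn => // /asboolP[] w wB; apply: eO.
  apply: le_lt_trans ke; apply: enorm_le_coord => j; rewrite !mxE.
  have := wB j; have := zx j => /= /andP[h1 h2] /andP[h3 h4].
  move: h1 h2 h3 h4; rewrite mulrDl div1r !mxE ler_norml => h1 h2 h3 h4.
  move: (k.+1%:R^-1) (_ / _) h1 h2 h3 h4 => kV zk h1 h2 h3 h4.
  by apply/andP; split; lra.
apply: countable_bigcupT_measurable; first exact: countableP.
by move=> p; case: ifP => // _; exact: measurable_box.
Qed.

(** For [O] the part of B_1 where [u > 9], a vertex in the erosion is at distance at least [eta]
    from its contact point. *)
Definition erosion O (eta : R) : set 'rV[R]_d :=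
  [set x | forall z, enorm (z - x) < eta -> O z].

(** The erosion is closed for any [O]: a point outside [O] within [eta] of [x] is also within [eta]
    of all points near [x]. *)
Lemma measurable_erosion O eta : measurable (tuple_set (erosion O eta)).
Proof.
have -> : tuple_set (erosion O eta) = ~` tuple_set (~` erosion O eta).
  by apply/seteqP; split => t /=; rewrite ?notK// => H1 H2; exact: H2.
apply: measurableC; apply: measurable_open; rewrite openE => x /= H.
have [z [zx zO]] : exists z, enorm (z - x) < eta /\ ~ O z.
  apply: contrapT => H'; apply: H => z zx; apply: contrapT => zO.
  by apply: H'; exists z.
apply/enorm_nbhsP; exists (eta - enorm (z - x)); first by rewrite subr_gt0.
move=> y yx H'; apply: zO; apply: H'.
have -> : z - y = (z - x) - (y - x) by rewrite opprB addrA subrK.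
by have := enormD (z - x) (- (y - x)); rewrite enormN; lra.
Qed.

(** Continuity of the measure from below along [eta = 1 / (n + 1)], since these erosions exhaust an
    open set. *)
Lemma erosion_volume O (v : \bar R) : open O -> (v < volume O)%E ->
  exists2 eta : R, 0 < eta & (v < volume (erosion O eta))%E.
Proof.
move=> oO; have [mu muE] := volume_measureP; rewrite muE => vO.
pose F n := tuple_set (erosion O n.+1%:R^-1).
have mF n : measurable (F n) by exact: measurable_erosion.
have FO : \bigcup_n F n = tuple_set O.
  apply/seteqP; split => [t [n _ Fn]|t Ot].
    by apply: Fn; rewrite subrr enorm0.
  have /enorm_nbhsP[e e0 eO] : nbhs (\row_(i < d) tnth t i) O.
    by move: oO; rewrite openE; exact.
  exists (Num.truncn e^-1) => // z zt; apply: eO; apply: lt_trans zt _.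
  by rewrite invf_plt ?posrE// truncnS_gt.
have ndF : nondecreasing_seq F.
  move=> n m nm; apply/subsetPset => t Ft z zt; apply: Ft.
  by apply: lt_le_trans zt _; rewrite lef_pV2 ?posrE// ler_nat.
have cF : mu (F n) @[n --> \oo] --> mu (tuple_set O).
  by rewrite -FO; apply: nondecreasing_cvg_mu => //; apply: bigcup_measurable.
apply: contrapT => H.
have : (mu (tuple_set O) <= v)%E.
  rewrite -(cvg_lim _ cF)//; apply: lime_le; first by apply: cvgP cF.
  apply: nearW => n; rewrite leNgt; apply/negP => vn; apply: H.
  by exists n.+1%:R^-1 => //; rewrite muE.
by rewrite leNgt vO.
Qed.

End Volume.

(* Applied with [F i] a small box in a contact cell and [G i] a large box around
   the corresponding vertices: no cell needs to be counted. *)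
Lemma packing_covering (dsp : measure_display) (T : measurableType dsp)
    (R : realType) (mu : {measure set T -> \bar R}) (I : finType) (S : set I)
    (F G : I -> set T) (A : set T) (K : R) : 0 <= K ->
  trivIset S F -> (forall i, measurable (F i)) -> (forall i, measurable (G i)) ->
  measurable A -> (forall i, mu (G i) = K%:E * mu (F i))%E ->
  A `<=` \bigcup_(i in S) G i ->
  (mu A <= K%:E * mu (\bigcup_(i in S) F i))%E.
Proof.
move=> K0 tF mF mG mA GF AG.
apply: le_trans (content_sub_fsum mu finite_finset (fun i _ => mG i) mA AG) _.
rewrite measure_fin_bigcup//; last exact: finite_finset.
rewrite ge0_mule_fsumr//.
by apply: lee_fsum => [|i _]; [exact: finite_finset|rewrite /= GF].
Qed.

(** * Grid cells and the measure contradiction *)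

Lemma grid_index (R : realType) (d m : nat) (y : 'rV[R]_d) : (0 < m)%N ->
  enorm y < 1 -> exists i : {ffun 'I_d -> 'I_m}, forall j,
    (i j)%:R * (2 / m%:R) <= y ord0 j + 1 <= ((i j)%:R + 1) * (2 / m%:R).
Proof.
move=> m0 y1; have mR : 0 < 2 / m%:R :> R by rewrite divr_gt0// ltr0n.
pose t j := Num.truncn ((y ord0 j + 1) / (2 / m%:R)).
have yj j : -1 < y ord0 j < 1.
  by rewrite -ltr_norml (le_lt_trans (coord_le_enorm _ _)).
have t0 j : 0 <= (y ord0 j + 1) / (2 / m%:R).
  by rewrite divr_ge0 ?(ltW mR)//; have := yj j; lra.
have tm j : (t j < m)%N.
  rewrite truncn_lt_nat// ltr_pdivrMr// mulrCA divff ?pnatr_eq0 -?lt0n//.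
  by have := yj j; lra.
exists [ffun j => Ordinal (tm j)] => j; rewrite ffunE /=.
have /andP[h1 h2] := truncn_itv (t0 j).
rewrite -ler_pdivlMr// h1 /= -ler_pdivrMr//.
by rewrite natr1 ltW.
Qed.

(** [T eta x y] abstracts contact at [y] of the cusp with vertex [x]. Vertices whose contacts share
    a cell lie in one box of comparable volume, and contact cells avoid the erosion; so the small
    complement of the erosion would control the volume of a fixed cube of vertices. *)
Lemma grid_covering (R : realType) (d : nat) (C c : R) : (0 < d)%N -> 0 < C -> 0 < c ->
  exists2 delta : R, 0 < delta & forall (O : set 'rV[R]_d)
    (T : R -> 'rV[R]_d -> 'rV[R]_d -> Prop),
  open O -> O `<=` eball 1 ->
  ((1 - delta)%:E * volume (@eball R d 1) < volume O)%E ->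
  (forall eta x, 0 < eta -> eball (1 / 4) x -> erosion O eta x ->
     exists y, T eta x y) ->
  (forall eta x y, T eta x y -> enorm y < 19 / 20 /\ ~ O y) ->
  (forall eta r x y x' y', 0 < eta -> 0 < r -> r <= c -> r <= c * eta ->
     T eta x y -> T eta x' y' -> enorm (y' - y) <= r -> enorm (x' - x) <= C * r) ->
  False.
Proof.
move=> d0 C0 c0; have dR : 1 <= d%:R :> R by rewrite (ler_nat R 1).
(* Volume ratio of a vertex box of half-side [C d h] to an inner box of side [h / 2]; [q] is the
   volume of the cube [Q0]. *)
pose K : R := (4 * C * d%:R) ^+ d.
pose q : R := (1 / (4 * d%:R)) ^+ d.
have K0 : 0 <= K by rewrite exprn_ge0// !mulr_ge0// ltW.
have q0 : 0 < q by rewrite exprn_gt0// divr_gt0// mulr_gt0//; lra.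
(* As [2^d] bounds the volume of B_1, this gives [(K + 1) delta |B_1| <= q / 2]. *)
pose delta := q / (2 * 2 ^+ d * (K + 1)).
have den0 : 0 < 2 * 2 ^+ d * (K + 1).
  by rewrite !mulr_gt0// ?exprn_gt0//; lra.
exists delta; first by rewrite divr_gt0.
move=> O T oO O1 vO Tex Tprop Tlip.
have [eta eta0 veta] := @erosion_volume _ _ _ _ oO vO.
have [mu muE] := @volume_measureP R d.
(* Bound on the cell diameter: [c] and [c eta] for the Lipschitz hypothesis, [eta / 2] to keep
   contact cells off the erosion, 1/20 to keep them in B_1. *)
pose rho := Num.min (Num.min c (c * eta)) (Num.min (eta / 2) (1 / 20)).
have rho0 : 0 < rho by rewrite !lt_min c0 mulr_gt0// divr_gt0//=; lra.
pose m := (Num.truncn (2 * d%:R / rho)).+1.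
pose h : R := 2 / m%:R.
have h0 : 0 < h by rewrite divr_gt0.
have dh0 : 0 < d%:R * h by rewrite mulr_gt0//; lra.
have hrho : d%:R * h <= rho.
  rewrite /h mulrCA mulrA ler_pdivrMr// [leRHS]mulrC -ler_pdivrMr// ltW//.
  exact: truncnS_gt.
have [hc hce he h20] : [/\ d%:R * h <= c, d%:R * h <= c * eta,
    d%:R * h <= eta / 2 & d%:R * h <= 1 / 20].
  by move: hrho; rewrite !le_min => /andP[/andP[-> ->] /andP[-> ->]].
pose cell (i : {ffun 'I_d -> 'I_m}) (y : 'rV[R]_d) :=
  forall j, (i j)%:R * h <= y ord0 j + 1 <= ((i j)%:R + 1) * h.
pose Q i y := [/\ eball (1 / 4) y.1, T eta y.1 y.2 & cell i y.2].
pose S := [set i | exists y, Q i y].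
pose sel i : 'rV[R]_d * 'rV[R]_d := xget (0, 0) [set y | Q i y].
have selP i : S i -> Q i (sel i) by case=> y Qy; exact: (xgetPex _ (ex_intro _ y Qy)).
(* The middle half of each cell: closed cells share faces, whereas these boxes are disjoint. *)
pose inner (i : {ffun 'I_d -> 'I_m}) :=
  box (fun j => (i j)%:R * h + h / 4 - 1) (fun j => (i j)%:R * h + 3 * h / 4 - 1)
   : set 'rV[R]_d.
pose big i := box (fun j => (sel i).1 ord0 j - C * (d%:R * h))
   (fun j => (sel i).1 ord0 j + C * (d%:R * h)).
have close i (y z : 'rV[R]_d) : cell i y -> cell i z -> enorm (z - y) <= d%:R * h.
  move=> yi zi; apply: enorm_le_coord => j; rewrite !mxE ler_norml.
  by have := yi j; have := zi j; lra.
have inner_cell i z : inner i z -> cell i z.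
  by move=> zi j; have := zi j; lra.
have vinner i : mu (tuple_set (inner i)) = ((h / 2) ^+ d)%:E.
  rewrite -muE volume_box; last by move=> j; lra.
  rewrite (eq_bigr (fun=> h / 2)) ?prodr_const ?card_ord// => j _.
  by field.
have vbig i : mu (tuple_set (big i)) = (K%:E * mu (tuple_set (inner i)))%E.
  rewrite vinner -muE volume_box; last first.
    by move=> j; have : 0 < C * (d%:R * h) by [rewrite mulr_gt0|]; lra.
  rewrite (eq_bigr (fun=> (4 * C * d%:R) * (h / 2))) ?prodr_const ?card_ord.
    by rewrite exprMn EFinM.
  by move=> j _; field.
have mB1 : measurable (tuple_set (@eball R d 1)) := measurable_open _ (eball_open 1).
have mE : measurable (tuple_set (erosion O eta)) := measurable_erosion O eta.
pose W := \bigcup_(i in S) tuple_set (inner i).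
have mW : measurable W.
  by apply: fin_bigcup_measurable; [exact: finite_finset|move=> i _; exact: measurable_box].
have tW : trivIset S (fun i => tuple_set (inner i)).
  move=> i i' Si Si' [t [ti ti']]; apply/ffunP => j; apply/val_inj/eqP => /=.
  have := ti j; have := ti' j; rewrite mxE => h1 h2.
  rewrite eqn_leq; apply/andP; split; rewrite leqNgt; apply/negP;
    rewrite -(ler_nat R) -[X in X <= _]natr1 => ii;
    have := ler_wpM2r (ltW h0) ii; rewrite mulrDl; move: h1 h2 h0; clear; lra.
have WB1 : W `<=` tuple_set (@eball R d 1).
  move=> t [i Si /inner_cell ti].
  have [_ /Tprop[y1 _] yi] := selP i Si; rewrite /tuple_set /= /eball /=.
  have := close _ _ _ yi ti => H.
  have := enorm_dist (\row_(i0 < d) tnth t i0) (sel i).2.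
  by move: H y1 h20; lra.
(* Each point of a contact cell is within [eta / 2] of a contact point, which lies outside [O]. *)
have WE : W `&` tuple_set (erosion O eta) = set0.
  apply/seteqP; split => // t [[i Si /inner_cell ti] te].
  have [_ Ty yi] := selP i Si; have [_ yO] := Tprop _ _ _ Ty.
  apply: yO; apply: te.
  by have := close _ _ _ ti yi; lra.
have B1fin : (mu (tuple_set (@eball R d 1)) <= (2 ^+ d)%:E)%E.
  have sub : tuple_set (@eball R d 1) `<=` tuple_set (@box R d (fun=> -1) (fun=> 1)).
    move=> t t1 j; rewrite -ler_norml.
    exact: le_trans (coord_le_enorm _ _) (ltW t1).
  apply: (@le_trans _ _ (mu (tuple_set (@box R d (fun=> -1) (fun=> 1))))).
    by apply: le_measure; rewrite ?inE//; exact: measurable_box.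
  rewrite -muE volume_box; last by move=> j; lra.
  by rewrite prodr_const card_ord opprK.
pose Q0 : set 'rV[R]_d := box (fun=> - (1 / (8 * d%:R))) (fun=> 1 / (8 * d%:R)).
have vQ0 : mu (tuple_set Q0) = q%:E.
  rewrite -muE volume_box; last first.
    by move=> j; have : 0 < 1 / (8 * d%:R) :> R by [rewrite divr_gt0// mulr_gt0//; lra|]; lra.
  rewrite (eq_bigr (fun=> 1 / (4 * d%:R))) ?prodr_const ?card_ord// => j _.
  by field; rewrite gt_eqF//; lra.
have Q0ball x : Q0 x -> eball (1 / 4) x.
  move=> x0; rewrite /eball /=.
  have : enorm x <= d%:R * (1 / (8 * d%:R)).
    by apply: enorm_le_coord => j; rewrite ler_norml; exact: x0.
  have -> : d%:R * (1 / (8 * d%:R)) = 1 / 8 :> R by field; rewrite gt_eqF//; lra.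
  lra.
have mQ0 : measurable (tuple_set Q0) := measurable_box _ _.
(* The contact point of a vertex shares a cell with the selected one, so the two vertices are within
   [C d h]. *)
have covered : tuple_set Q0 `&` tuple_set (erosion O eta)
    `<=` \bigcup_(i in S) tuple_set (big i).
  move=> t [Qt te]; have xb := Q0ball _ Qt; set x := \row_(i < d) _ in xb.
  have [y Ty] := Tex eta x eta0 xb te.
  have [y1 _] := Tprop _ _ _ Ty.
  have y1' : enorm y < 1 by lra.
  have [i yi] := @grid_index R d m y isT y1'.
  have Si : S i by exists (x, y).
  exists i => //; have [_ Ty' yi'] := selP i Si => j.
  have := Tlip eta _ _ _ _ _ eta0 dh0 hc hce Ty' Ty (close _ _ _ yi' yi).
  move=> /(le_trans (coord_le_enorm _ j)); rewrite !mxE ler_norml.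
  by lra.
have cov := packing_covering _ _ _ mu _ S _ _ _ K K0 tW
  (fun i => measurable_box _ _) (fun i => measurable_box _ _)
  (measurableI _ _ mQ0 mE) vbig covered.
rewrite -/W in cov.
have EB1 : tuple_set (erosion O eta) `<=` tuple_set (@eball R d 1).
  by move=> t te; apply: O1; apply: te; rewrite subrr enorm0.
have mD : measurable (tuple_set (@eball R d 1) `\` tuple_set (erosion O eta)).
  exact: measurableD.
have Q0le : (mu (tuple_set Q0) <= mu (tuple_set Q0 `&` tuple_set (erosion O eta))
    + mu (tuple_set (@eball R d 1) `\` tuple_set (erosion O eta)))%E.
  apply: le_trans (measureU2 mu _ _); last 2 first.
  - exact: measurableI.
  - exact: mD.
  apply: le_measure; rewrite ?inE//; first by apply: measurableU => //; exact: measurableI.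
  move=> t Qt; have [te|te] := pselect (tuple_set (erosion O eta) t); [by left|right].
  split => //; have /Q0ball := Qt.
  by rewrite /tuple_set /eball /=; lra.
have Wle : W `<=` tuple_set (@eball R d 1) `\` tuple_set (erosion O eta).
  move=> t Wt; split; first exact: WB1.
  by move=> te; have : (W `&` tuple_set (erosion O eta)) t by []; rewrite WE.
have WleM : (mu W <= mu (tuple_set (@eball R d 1) `\` tuple_set (erosion O eta)))%E.
  by apply: le_measure; rewrite ?inE.
have split1 : mu (tuple_set (@eball R d 1)) = (mu (tuple_set (erosion O eta)) +
    mu (tuple_set (@eball R d 1) `\` tuple_set (erosion O eta)))%E.
  rewrite -measureU//; first by rewrite setDUK.
  by rewrite setDIK.
have fin A : A `<=` tuple_set (@eball R d 1) -> measurable A -> mu A \is a fin_num.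
  move=> AB mA; rewrite ge0_fin_numE//.
  apply: (@le_lt_trans _ _ (2 ^+ d)%:E); last exact: ltry.
  by apply: le_trans B1fin; apply: le_measure; rewrite ?inE.
have fB := fin _ (@subset_refl _ _) mB1.
have fE := fin _ EB1 mE.
have fD := fin _ (@subDsetl _ _ _) mD.
have fW := fin _ WB1 mW.
move: veta Q0le cov WleM split1 B1fin; rewrite !muE vQ0.
rewrite -(fineK fB) -(fineK fE) -(fineK fD) -(fineK fW).
move: (fine _) (fine _) (fine _) (fine _) => vW vD vE vB.
move=> veta Q0le cov; have {}Q0le := le_trans Q0le (leeD2r _ cov).
move: veta Q0le; rewrite -!EFinM -!EFinD lte_fin !lee_fin => veta Q0le WD [vBE] B2.
(* Altogether [q <= K vW + vD <= (K + 1) vD <= q / 2], which is absurd. *)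
have KW : K * vW <= K * vD by rewrite ler_wpM2l.
have D1 : vD < delta * vB by lra.
have D2 : delta * vB <= delta * 2 ^+ d by rewrite ler_wpM2l// divr_ge0// ltW.
have D3 : delta * 2 ^+ d * (K + 1) = q / 2.
  rewrite /delta; field; rewrite !gt_eqF ?exprn_gt0//; lra.
have D4 : (K + 1) * vD <= (K + 1) * (delta * 2 ^+ d) by rewrite ler_wpM2l//; lra.
by lra.
Qed.

(** * The covering contradiction for contact points of cusps *)

Theorem lemma3p1 (R : realType) (d : nat) (lambda Lambda : R)
    (hd : (1 <= d)%N) (hlambda : 0 < lambda) (hLambda : lambda <= Lambda) :
  exists eps0 delta M : R,
    [/\ 0 < eps0, 0 < delta, 0 < M
      & forall gamma : R, 0 <= gamma -> gamma <= eps0 ->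
        forall u : 'rV[R]_d -> R,
          lsc_in (eball 1) u ->
          (forall x : 'rV[R]_d, eball 1 x -> 0 <= u x) ->
          visc_Mminus_le lambda Lambda gamma 1 (eball 1) u ->
          ((1 - delta)%:E * volume (@eball R d 1)
             < volume ([set x | (M < u x)%R] `&` eball 1))%E ->
          forall x : 'rV[R]_d, eball (1 / 4) x -> 1 < u x].
Proof.
have [C [c [C0 c0 lip]]] := @vertex_lipschitz R d _ _ hlambda hLambda.
have [delta delta0 cover] := grid_covering R d C c hd C0 c0.
(* 1/10 is the threshold on [gamma] in [vertex_lipschitz], and 9 the bound on [u] at contact points
   in [cusp_contact]. *)
exists (1 / 10), delta, 9; split; [lra|by []|lra|].
move=> gamma _ g1 u lu u0 vu vol x0 x0b; rewrite ltNge; apply/negP => ux0.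
pose T eta x y := [/\ eball (1 / 4) x, enorm y < 19 / 20, u y <= 9,
  cusp_touches u x y & eta <= enorm (y - x)].
apply: (cover _ T _ _ vol).
- rewrite openE => x [/= ux xb]; apply: filterI; last first.
    by have := @eball_open R d 1; rewrite openE; exact.
  by move/(lsc_inP _ (eball_open 1)): lu; apply.
- by move=> x [].
- move=> eta x eta0 xb xO.
  have [y [y1 uy xy]] := cusp_contact _ _ _ lu u0 x0b ux0 xb.
  (* A contact closer than [eta] to a vertex in the erosion would have [u y > 9]. *)
  exists y; split => //; rewrite leNgt; apply/negP => /xO[/=]; lra.
- by move=> eta x y [_ y1 uy _ _]; split => // -[/=]; lra.
move=> eta r x y x' y' eta0 r0 rc rce [xb yb _ xy exy] [xb' yb' _ xy' exy'].
exact: (lip gamma u x y x' y' eta r).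
Qed.
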